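(* Let $(M,F)$ be an $n$-dimensional complex Finsler space. The following assertions are equivalent: i) $(M,F)$ is $G$-Kähler; ii) $\overset{B}{L}{}^i_{j\bar k}=\overset{c}{L}{}^i_{j\bar k}$; iii) $\overset{B}{L}{}^i_{jk}=L^i_{jk}$ and these functions depend only on $z$; iv) $(M,F)$ is a complex Berwald space; v) $g_{i\bar j\overset{B}{|}k}=0$ and $\dot\partial_{\bar h}G^i=0$. (All identities are required for all values of the free indices and at all points of $\widetilde{T'M}$.)
   Context: Let $M$ be an $n$-dimensional complex manifold, $T'M$ its holomorphic tangent bundle with local coordinates $(z^k,\eta^k)$, and $\widetilde{T'M}=T'M\setminus\{0\}$ (zero section removed). A complex Finsler space $(M,F)$ is given by a continuous $F:T'M\to[0,\infty)$ with: $L:=F^2$ smooth on $\widetilde{T'M}$; $F(z,\eta)=0$ iff $\eta=0$; $F(z,\lambda\eta)=|\lambda|F(z,\eta)$ for $\lambda\in\mathbb C$; and the Hermitian matrix $g_{i\bar j}:=\partial^2L/\partial\eta^i\partial\bar\eta^j$ positive definite. $(g^{\bar j i})$ is the inverse matrix, $g^{\bar j i}g_{k\bar j}=\delta^i_k$. Notation: $\dot\partial_k=\partial/\partial\eta^k$, $\dot\partial_{\bar k}=\partial/\partial\bar\eta^k$; summation convention. Chern–Finsler connection coefficients: $N^i_j:=g^{\bar mi}\frac{\partial g_{l\bar m}}{\partial z^j}\eta^l$, $L^i_{jk}:=g^{\bar li}\delta_kg_{j\bar l}=\dot\partial_jN^i_k$ with $\delta_k:=\frac{\partial}{\partial z^k}-N^j_k\dot\partial_j$.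 Spray coefficients $G^i:=\tfrac12N^i_j\eta^j$; $\overset{c}{N}{}^i_j:=\dot\partial_jG^i$, $\overset{c}{\delta}_k:=\frac{\partial}{\partial z^k}-\overset{c}{N}{}^j_k\dot\partial_j$, and $\overset{c}{\delta}_{\bar k}$ its conjugate. Berwald coefficients: $\overset{B}{L}{}^i_{jk}:=\dot\partial_k\overset{c}{N}{}^i_j$, $\overset{B}{L}{}^i_{j\bar k}:=\dot\partial_{\bar k}\overset{c}{N}{}^i_j$. Rund mixed coefficients: $\overset{c}{L}{}^i_{j\bar k}:=\tfrac12g^{\bar li}(\overset{c}{\delta}_{\bar k}g_{j\bar l}-\overset{c}{\delta}_{\bar l}g_{j\bar k})$. Barred-index coefficients are conjugates: $\overset{B}{L}{}^{\bar\imath}_{\bar jk}=\overline{\overset{B}{L}{}^i_{j\bar k}}$. The $h$-covariant derivative of $g$ with respect to the Berwald connection is $g_{i\bar j\overset{B}{|}k}=\overset{c}{\delta}_kg_{i\bar j}-\overset{B}{L}{}^l_{ik}g_{l\bar j}-\overset{B}{L}{}^{\bar m}_{\bar jk}g_{i\bar m}$. $(M,F)$ is Kähler if $T^i_{jk}\eta^j=0$, where $T^i_{jk}:=L^i_{jk}-L^i_{kj}$. It is $G$-Kähler if it is Kähler and the spray coefficients are holomorphic in $\eta$, i.e. $\dot\partial_{\bar k}G^i=0$. It is a complex Berwald space if it is Kähler and the functions $L^i_{jk}$ depend only on $z$. *)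

(* Defs.v *)
From HB Require Import structures.
From mathcomp Require Import all_boot all_order all_algebra.
From mathcomp Require Import all_classical all_reals all_analysis.
From mathcomp.real_closed Require Import complex.
Set Implicit Arguments.
Unset Strict Implicit.
Unset Printing Implicit Defensive.
Import Order.TTheory GRing.Theory Num.Theory numFieldNormedType.Exports.
Local Open Scope classical_set_scope.
Local Open Scope ring_scope.
Local Open Scope complex_scope.

(* R[i] with the topology and the norm of the numFieldType R[i]. *)
HB.instance Definition _ (R : realType) := NormedModule.copy R[i] R[i]^o.

Section ComplexManifold.
Variables (R : realType) (n : nat).

(* The manifold is given by an atlas: [chart_map a] is a homeomorphism, with
   inverse [chart_inv a], of the open set [chart_dom a] onto an open subset of
   C^n, and the changes of coordinates are holomorphic, i.e. Frechet
   differentiable over the field R[i]. *)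
Record complexManifold := ComplexManifold {
  carrier : topologicalType;
  chart : Type;
  chart_dom : chart -> set carrier;
  chart_map : chart -> carrier -> 'rV[R[i]]_n;
  chart_inv : chart -> 'rV[R[i]]_n -> carrier;
  hausdorff_carrier : hausdorff_space carrier;
  second_countable_carrier : @second_countable carrier;
  chart_dom_open : forall a, open (chart_dom a);
  chart_dom_cover : forall q, exists a, chart_dom a q;
  chart_map_open : forall a, open (chart_map a @` chart_dom a);
  chart_mapK : forall a q, chart_dom a q -> chart_inv a (chart_map a q) = q;
  chart_map_continuous : forall a,
    {within chart_dom a, continuous (chart_map a)};
  chart_inv_continuous : forall a,
    {within chart_map a @` chart_dom a, continuous (chart_inv a)};
  transition_holomorphic : forall a b z,
    (chart_map a @` (chart_dom a `&` chart_dom b)) z ->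
    differentiable (chart_map b \o chart_inv a) z }.

End ComplexManifold.

Section LocalCalculus.
Variables (R : realType) (n : nat).

(* Points (z, eta) of C^n x C^n. *)
Definition pt := ('rV[R[i]]_n * 'rV[R[i]]_n)%type.
Implicit Types (f : pt -> R[i]) (p v : pt) (i j k l m h : 'I_n).

Definition rderivable f v p : Prop :=
  derivable (fun t : R => complex.Re (f (p + t%:C *: v))) 0 1 /\
  derivable (fun t : R => complex.Im (f (p + t%:C *: v))) 0 1.

(* The derivative at p of the restriction of f to the real line p + R v. *)
Definition rderive v f p : R[i] :=
  derive1 (fun t : R => complex.Re (f (p + t%:C *: v))) 0 +i*
  derive1 (fun t : R => complex.Im (f (p + t%:C *: v))) 0.

Fixpoint Ck (r : nat) (W : set pt) f : Prop :=
  {within W, continuous f} /\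
  if r is r'.+1 then
    forall v, (forall p, W p -> rderivable f v p) /\ Ck r' W (rderive v f)
  else True.

Definition smooth (W : set pt) f := forall r, Ck r W f.

(* Wirtinger derivatives along the complex line spanned by v. *)
Definition wirtinger v f p : R[i] :=
  2^-1 * (rderive v f p - 'i * rderive ('i *: v) f p).
Definition wirtinger_bar v f p : R[i] :=
  2^-1 * (rderive v f p + 'i * rderive ('i *: v) f p).

Definition dz k f := wirtinger (delta_mx 0 k, 0) f.
Definition dzb k f := wirtinger_bar (delta_mx 0 k, 0) f.
Definition deta k f := wirtinger (0, delta_mx 0 k) f.
Definition detab k f := wirtinger_bar (0, delta_mx 0 k) f.

Section Coefficients.
(* F^2 in a chart; in the names below the suffix b marks a barred index. *)
Variable L : pt -> R[i].

(* gten i j = g_{i jbar} *)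
Definition gten i j p : R[i] := deta i (detab j L) p.
Definition gmx p : 'M[R[i]]_n := \matrix_(i, j) gten i j p.
(* ginv j i = g^{jbar i}, with g^{jbar i} g_{k jbar} = delta^i_k *)
Definition ginv j i p : R[i] := invmx (gmx p) j i.

(* Adapted frames of a nonlinear connection N, with N j k = N^j_k. *)
Definition hderive (N : 'I_n -> 'I_n -> pt -> R[i]) k f p : R[i] :=
  dz k f p - \sum_j N j k p * deta j f p.
Definition hderive_bar (N : 'I_n -> 'I_n -> pt -> R[i]) k f p : R[i] :=
  dzb k f p - \sum_j (N j k p)^* * detab j f p.

(* Chern-Finsler connection: N^i_j and L^i_{jk} *)
Definition cfN i j p : R[i] :=
  \sum_m \sum_l ginv m i p * dz j (gten l m) p * p.2 0 l.
Definition cfL i j k p : R[i] :=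
  \sum_l ginv l i p * hderive cfN k (gten j l) p.
Definition torsion i j k p : R[i] := cfL i j k p - cfL i k j p.

Definition spray i p : R[i] := 2^-1 * \sum_j cfN i j p * p.2 0 j.
Definition cN i j p : R[i] := deta j (spray i) p.

(* Berwald connection: ^B L^i_{jk} and ^B L^i_{j kbar} *)
Definition BL i j k p : R[i] := deta k (cN i j) p.
Definition BLb i j k p : R[i] := detab k (cN i j) p.

(* Rund connection: ^c L^i_{j kbar} *)
Definition cLb i j k p : R[i] :=
  2^-1 * \sum_l ginv l i p *
    (hderive_bar cN k (gten j l) p - hderive_bar cN l (gten j k) p).

(* g_{i jbar |k} for the Berwald connection; ^B L^{mbar}_{jbar k} is the
   conjugate of ^B L^m_{j kbar}. *)
Definition Bcov_g i j k p : R[i] :=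
  hderive cN k (gten i j) p - \sum_l BL l i k p * gten l j p
    - \sum_m (BLb m j k p)^* * gten i m p.

End Coefficients.

End LocalCalculus.

Section FinslerSpace.
Variables (R : realType) (n : nat) (M : complexManifold R n).
Implicit Types (a b : chart M) (p : pt R n) (i j k l h : 'I_n).

(* T'M and T'M minus the zero section over the chart a, in the induced
   coordinates. *)
Definition tdom a : set (pt R n) :=
  [set p | (chart_map a @` chart_dom a) p.1].
Definition slit a : set (pt R n) := [set p | tdom a p /\ p.2 != 0].

(* A complex Finsler metric F : T'M -> [0, oo[, given by its expressions
   [metric a] in the charts; [metric_compat] says that they define a function
   on T'M, whose transition maps are (z, eta) |-> (tau z, d tau_z eta). *)
Record finslerMetric := FinslerMetric {
  metric : chart M -> pt R n -> R;
  metric_compat : forall a b (z eta : 'rV[R[i]]_n),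
    (chart_map a @` (chart_dom a `&` chart_dom b)) z ->
    let tau := chart_map b \o chart_inv a in
    metric b (tau z, 'd tau z eta) = metric a (z, eta);
  metric_ge0 : forall a p, tdom a p -> 0 <= metric a p;
  metric_continuous : forall a, {within tdom a, continuous (metric a)};
  metric_smooth : forall a,
    smooth (slit a) (fun p => ((metric a p) ^+ 2)%:C);
  metric_eq0 : forall a p, tdom a p -> metric a p = 0 <-> p.2 = 0;
  metric_homogeneous : forall a (z eta : 'rV[R[i]]_n) (c : R[i]),
    tdom a (z, eta) ->
    (metric a (z, c *: eta))%:C = `|c| * (metric a (z, eta))%:C;
  metric_posdef : forall a p (v : 'rV[R[i]]_n), slit a p -> v != 0 ->
    0 < \sum_i \sum_j
          gten (fun q => ((metric a q) ^+ 2)%:C) i j p * v 0 i * (v 0 j)^* }.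

Variable F : finslerMetric.

Definition lagrangian a p : R[i] := ((metric F a p) ^+ 2)%:C.

(* The coefficient f, given in every chart, depends only on z. *)
Definition only_z (f : chart M -> pt R n -> R[i]) : Prop :=
  forall a z eta eta', slit a (z, eta) -> slit a (z, eta') ->
    f a (z, eta) = f a (z, eta').

Definition kahler : Prop := forall a p, slit a p ->
  forall i k, \sum_j torsion (lagrangian a) i j k p * p.2 0 j = 0.

Definition spray_holomorphic : Prop := forall a p, slit a p ->
  forall i k, detab k (spray (lagrangian a) i) p = 0.

Definition G_kahler : Prop := kahler /\ spray_holomorphic.

Definition berwald : Prop :=
  kahler /\ forall i j k, only_z (fun a => cfL (lagrangian a) i j k).

End FinslerSpace.

(* Main.v *)
(* The argument is local on T'M minus its zero section. Write N for the
   Chern-Finsler coefficients. Homogeneity of L = F^2 and Euler's identity give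
   L^i_{jk} = d N^i_k / d eta^j and T^i_{jk} eta^j = 2 (N^i_k - cN^i_k), so
   "Kaehler" means N = cN, and then ^B L^i_{jk} = L^i_{jk}.
   - G-Kaehler implies that L^i_{jk} depends only on z: it is holomorphic and
     homogeneous of degree 0 in eta, so t |-> L^i_{jk}(z, eta + t zeta) is entire
     with limit L^i_{jk}(z, zeta) at infinity, hence constant.
   - ii) implies G-Kaehler: g_{i rbar} dbar_k G^i is always symmetric in r, k,
     because 2 g_{i rbar} G^i = eta^j d_{z^j} dbar_r L, while contracting ii)
     with eta^j makes it antisymmetric. Hence dbar_k G^i = 0, both sides of ii)
     vanish, and contracting the right-hand side with conj(eta^r) gives the
     Kaehler condition.
   - v) contracted with eta^i gives N = cN. *)

Require Import Defs.
From HB Require Import structures.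
From mathcomp Require Import all_boot all_order all_algebra.
From mathcomp Require Import all_classical all_reals all_analysis.
From mathcomp.real_closed Require Import complex.
From mathcomp Require Import ring lra.
Set Implicit Arguments.
Unset Strict Implicit.
Unset Printing Implicit Defensive.
Import Order.TTheory GRing.Theory Num.Theory numFieldNormedType.Exports.
Local Open Scope classical_set_scope.
Local Open Scope ring_scope.
Local Open Scope complex_scope.

(** * Functions of two real variables *)

(** [rderive] looks at one real line at a time, so neither additivity in the direction nor
    commutation of derivatives is built in. Both are recovered on two-dimensional slices from the
    mean value theorem and the continuity of the derivatives; after that the Wirtinger calculus is
    formal. The Liouville step is a maximum principle rather than a Cauchy estimate: it uses only
    that the real part of a holomorphic function is harmonic on a complex line, hence only second
    derivatives along two real directions. That complex line must avoid the zero section, so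
    proportional vectors are handled apart, by homogeneity alone. Identities between connection
    coefficients are checked with the upper index lowered by [gten]: the inverse matrix then
    disappears, and every term is an iterated derivative of [L] or a product of such derivatives
    with coefficients of the connection. *)

Section TwoVariables.
Variable R : realType.
Implicit Types (h : R -> R -> R) (f : R -> R).

(** Keeping only the bound on [c] treats both signs of [t] at once, as two-sided limits at 0
    require. *)
Lemma MVT_sym f (df : R -> R) (t : R) :
  (forall x : R, `|x| <= `|t| -> is_derive x (1 : R) f (df x)) ->
  exists2 c : R, `|c| <= `|t| & f t - f 0 = df c * t.
Proof.
move=> fdf.
have cf (a b : R) : (forall x, x \in `[a, b] -> `|x| <= `|t|) ->
    {within `[a, b], continuous f}.
  move=> ab; apply: derivable_within_continuous => x /ab /fdf [] //.
have [t0|t0|->] := ltrgtP t 0; last first.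
- by exists 0 => //; rewrite subrr mulr0.
- have ab x : x \in `[0, t] -> `|x| <= `|t|.
    by rewrite in_itv /= => /andP[x0 xt]; rewrite (gtr0_norm t0) ger0_norm.
  have [x xt|c ct ->] := @MVT _ f df 0 t t0 _ (cf _ _ ab).
    by apply/fdf/ab/subset_itv_oo_cc.
  by exists c; rewrite ?subr0//; apply/ab/subset_itv_oo_cc.
- have ab x : x \in `[t, 0] -> `|x| <= `|t|.
    by rewrite in_itv /= => /andP[tx x0]; rewrite (ler0_norm (ltW t0)) ler0_norm // lerN2.
  have [x xt|c ct e] := @MVT _ f df t 0 t0 _ (cf _ _ ab).
    by apply/fdf/ab/subset_itv_oo_cc.
  exists c; first exact/ab/subset_itv_oo_cc.
  by rewrite -opprB e sub0r mulrN opprK.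
Qed.

Lemma is_derive_lim f (x d : R) :
  (fun k : R => k^-1 * (f (x + k) - f x)) @ 0^' --> d -> is_derive x (1 : R) f d.
Proof.
move=> fd.
have e : (fun k : R => k^-1 *: ((f \o shift x) (k *: 1) - f x)) =
    (fun k : R => k^-1 * (f (x + k) - f x)).
  by apply: funext => k /=; rewrite [k *: 1]mulr1 (addrC k).
have fd' : (fun k : R => k^-1 *: ((f \o shift x) (k *: 1) - f x)) @ 0^' --> d.
  by rewrite e.
apply: DeriveDef; first by apply/cvg_ex; exists d.
by apply: cvg_lim.
Qed.

(** Split the increment at [h 0 t]: the mean value theorem and the continuity of [h1] at the origin
    give the first part, and [d2] is the derivative of the second. *)
Lemma is_derive_diag h (h1 : R -> R -> R) (e d2 : R) : 0 < e ->
  (forall s t : R, `|s| < e -> `|t| < e -> is_derive s (1 : R) (h ^~ t) (h1 s t)) ->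
  (fun z : R * R => h1 z.1 z.2) @ (0, 0) --> h1 0 0 ->
  is_derive (0 : R) (1 : R) (h 0) d2 ->
  is_derive (0 : R) (1 : R) (fun t => h t t) (h1 0 0 + d2).
Proof.
move=> e0 hh1 ch1 hd2.
suff hd1 : is_derive (0 : R) (1 : R) (fun t => h t t - h 0 t) (h1 0 0).
  have -> : (fun t => h t t) = (fun t => h t t - h 0 t) + h 0.
    by apply/funext => t /=; rewrite fctE subrK.
  exact: is_deriveD.
apply: is_derive_lim; apply/cvgrPdist_le => eps eps0.
have /cvgrPdist_le/(_ _ eps0) := ch1.
move=> [[A B]] /= [/nbhs_ballP[a a0 aA] /nbhs_ballP[b b0 bB]] AB.
near=> t.
have te : `|t| < e by near: t; apply: dnbhs0_lt.
have ta : `|t| < a by near: t; apply: dnbhs0_lt.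
have tb : `|t| < b by near: t; apply: dnbhs0_lt.
have [x xt|c ct E] := @MVT_sym (h ^~ t) (h1 ^~ t) t.
  by apply: hh1 => //; apply: le_lt_trans xt _.
rewrite add0r !subrr subr0 E mulrCA mulVf; last by near: t; exact: nbhs_dnbhs_neq.
rewrite mulr1; apply: (AB (c, t)); split => /=.
  by apply: aA; rewrite /ball /= sub0r normrN (le_lt_trans ct).
by apply: bB; rewrite /ball /= sub0r normrN.
Unshelve. all: by end_near. Qed.

(** Two mean value theorems, first in [s] for the difference of two slices, then in [t] for [h1],
    turn the second difference over a square into [h12 c c' * t * t]. *)
Lemma mixed_difference h (h1 h12 : R -> R -> R) (e : R) : 0 < e ->
  (forall s t : R, `|s| < e -> `|t| < e -> is_derive s (1 : R) (h ^~ t) (h1 s t)) ->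
  (forall s t : R, `|s| < e -> `|t| < e -> is_derive t (1 : R) (h1 s) (h12 s t)) ->
  (fun z : R * R => h12 z.1 z.2) @ (0, 0) --> h12 0 0 ->
  (fun t => t^-1 * (t^-1 * (h t t - h t 0 - h 0 t + h 0 0))) @ 0^' --> h12 0 0.
Proof.
move=> e0 hh1 hh12 ch12; apply/cvgrPdist_le => eps eps0.
have /cvgrPdist_le/(_ _ eps0) := ch12.
move=> [[A B]] /= [/nbhs_ballP[a a0 aA] /nbhs_ballP[b b0 bB]] AB.
near=> t.
have t0 : t != 0 by near: t; exact: nbhs_dnbhs_neq.
have te : `|t| < e by near: t; apply: dnbhs0_lt.
have ta : `|t| < a by near: t; apply: dnbhs0_lt.
have tb : `|t| < b by near: t; apply: dnbhs0_lt.
have [x xt|c ct E] := @MVT_sym ((h ^~ t) - (h ^~ 0)) (fun s => h1 s t - h1 s 0) t.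
  by apply: is_deriveB; apply: hh1; rewrite ?normr0//; apply: le_lt_trans xt _.
have ce := le_lt_trans ct te.
have [x xt|c' ct' E'] := @MVT_sym (h1 c) (h12 c) t.
  by apply: hh12; rewrite ?normr0//; apply: le_lt_trans xt _.
have -> : h t t - h t 0 - h 0 t + h 0 0 = h12 c c' * t * t.
  by rewrite -E' -E !fctE; ring.
have -> : t^-1 * (t^-1 * (h12 c c' * t * t)) = h12 c c' by field.
apply: (AB (c, c')); split => /=.
  by apply: aA; rewrite /ball /= sub0r normrN (le_lt_trans ct).
by apply: bB; rewrite /ball /= sub0r normrN (le_lt_trans ct').
Unshelve. all: by end_near. Qed.

(** The second difference is symmetric in the two variables, so both mixed derivatives are limits of
    the same quotient. *)
Lemma schwarz h (h1 h2 h12 h21 : R -> R -> R) (e : R) : 0 < e ->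
  (forall s t : R, `|s| < e -> `|t| < e -> is_derive s (1 : R) (h ^~ t) (h1 s t)) ->
  (forall s t : R, `|s| < e -> `|t| < e -> is_derive t (1 : R) (h s) (h2 s t)) ->
  (forall s t : R, `|s| < e -> `|t| < e -> is_derive t (1 : R) (h1 s) (h12 s t)) ->
  (forall s t : R, `|s| < e -> `|t| < e -> is_derive s (1 : R) (h2 ^~ t) (h21 s t)) ->
  (fun z : R * R => h12 z.1 z.2) @ (0, 0) --> h12 0 0 ->
  (fun z : R * R => h21 z.1 z.2) @ (0, 0) --> h21 0 0 ->
  h12 0 0 = h21 0 0.
Proof.
move=> e0 hh1 hh2 hh12 hh21 c12 c21.
have l1 := mixed_difference e0 hh1 hh12 c12.
have := @mixed_difference (fun s t => h t s) (fun s t => h2 t s)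
  (fun s t => h21 t s) e e0.
move=> /(_ (fun s t se te => hh2 t s te se) (fun s t se te => hh21 t s te se)).
have c21' : (fun z : R * R => h21 z.2 z.1) @ (0, 0) --> h21 0 0.
  apply: (@cvg_comp _ _ _ (fun z : R * R => (z.2, z.1)) (fun z => h21 z.1 z.2)
    _ (nbhs (0, 0)) _ _ c21).
  by apply: (@cvg_pair _ _ _ _ (nbhs (0 : R)) (nbhs (0 : R))); [apply: cvg_snd|apply: cvg_fst].
move=> /(_ c21') l2.
have E : (fun t : R => t^-1 * (t^-1 * (h t t - h 0 t - h t 0 + h 0 0))) =
   (fun t : R => t^-1 * (t^-1 * (h t t - h t 0 - h 0 t + h 0 0))).
  by apply/funext => t; rewrite (addrAC (h t t)).
rewrite E in l2.
exact: cvg_unique l1 l2.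
Qed.

(** If [d] were positive, [df] would vanish at 0 and be positive just to the right of it, so [f]
    would exceed [f 0] there. *)
Lemma second_derivative_max f (df : R -> R) (d e : R) : 0 < e ->
  (forall t : R, `|t| < e -> is_derive t (1 : R) f (df t)) ->
  is_derive (0 : R) (1 : R) df d ->
  (forall t : R, `|t| < e -> f t <= f 0) -> d <= 0.
Proof.
move=> e0 fdf dfd fmax; rewrite leNgt; apply/negP => d0.
have df0 : df 0 = 0.
  have f0 : is_derive (0 : R) (1 : R) f 0.
    apply: (@derive1_at_max _ f (- e) e); rewrite ?in_itv/= ?oppr_lt0 ?e0//.
    - by rewrite ge0_cp// ltW.
    - by move=> t; rewrite in_itv/= -ltr_norml => /fdf[].
    - by move=> t; rewrite in_itv/= -ltr_norml => /fmax.
  have [|_ <-] := fdf 0; first by rewrite normr0.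
  by case: f0.
have [/cvg_ex[/= l hl] E] := dfd.
have {}hl : (fun k : R => k^-1 *: ((df \o shift 0) (k *: 1) - df 0)) @ 0^' --> d.
  by rewrite -E /derive; apply/cvg_ex; exists l.
have /cvgrPdist_lt/(_ _ d0) := hl.
rewrite /= -nbhs_nearE /dnbhs => /nbhs_ballP[a /= a0 aB].
have df_gt0 t : 0 < t -> t < a -> 0 < df t.
  move=> t0 ta; have := aB t; rewrite /ball/= sub0r normrN gtr0_norm// => /(_ ta).
  move=> /(_ (lt0r_neq0 t0)); rewrite [t *: 1]mulr1 addr0 df0 subr0.
  rewrite ltr_distlC subrr => /andP[+ _]; rewrite [_ *: _]/(_ * _).
  by rewrite pmulr_rgt0 // invr_gt0.
pose t := Num.min e a / 2.
have m0 : 0 < Num.min e a by rewrite lt_min e0.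
have t0 : 0 < t by rewrite divr_gt0.
have tm : t < Num.min e a by rewrite ltr_pdivrMr// mulr_natr mulr2n ltrDl.
have /andP[te ta] : (t < e) && (t < a) by rewrite -lt_min.
have [x|x|c] := @MVT _ f df 0 t t0.
- rewrite in_itv/= => /andP[x0 xt]; apply: fdf.
  by rewrite gtr0_norm// (lt_trans xt).
- apply: derivable_within_continuous => y; rewrite in_itv/= => /andP[y0 yt].
  by have [] // := fdf y; rewrite ger0_norm// (le_lt_trans yt).
rewrite in_itv/= subr0 => /andP[c0 ct] E'.
have := fmax t; rewrite gtr0_norm// => /(_ te); rewrite -subr_le0 E' leNgt.
by rewrite mulr_gt0// df_gt0// (lt_trans ct).
Qed.
End TwoVariables.

(** * Real directional derivatives *)

Section ComplexTopology.
Variable R : realType.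

Lemma near_dist_lt (K : numFieldType) (V : normedModType K) (t : V) (e : K) :
  0 < e -> \forall s \near t, `|t - s| < e.
Proof.
move=> e0; apply: (@cvgr_dist_lt _ _ _ (nbhs t) _ id t) => //; exact: cvg_id.
Qed.

Lemma conjCE (x : R[i]) : (x^*)%R = conjc x.
Proof. by []. Qed.

Lemma conjCD (x y : R[i]) : ((x + y)^*)%R = (x^*)%R + (y^*)%R.
Proof. exact: rmorphD. Qed.

Lemma conjCN (x : R[i]) : ((- x)^*)%R = - (x^*)%R.
Proof. exact: rmorphN. Qed.

Lemma conjCM (x y : R[i]) : ((x * y)^*)%R = (x^*)%R * (y^*)%R.
Proof. exact: rmorphM. Qed.

Lemma conjC_sum (I : finType) (F : I -> R[i]) :
  ((\sum_i F i)^*)%R = \sum_i ((F i)^*)%R.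
Proof. exact: rmorph_sum. Qed.

Lemma continuous_real_complex : continuous (fun t : R => t%:C).
Proof.
move=> t; apply/cvgrPdist_lt => e e0.
(* Radii of balls in [R[i]] are themselves complex numbers; a positive one is real. *)
have [e1 eE] : exists e1 : R, e = e1%:C.
  by exists (complex.Re e); rewrite RRe_real// gtr0_real.
rewrite eE in e0 *; rewrite ltcR in e0.
have := near_dist_lt t e0; apply: filterS => s ts.
by rewrite -rmorphB normc_def /= expr0n /= addr0 sqrtr_sqr ltcR.
Qed.

Lemma normc_ge_Im (x : R[i]) : `|complex.Im x|%:C <= `|x|.
Proof.
rewrite normc_def lecR -sqrtr_sqr ler_wsqrtr// lerDr; exact: sqr_ge0.
Qed.

Lemma continuous_Re : continuous (@complex.Re R : R[i] -> R).
Proof.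
move=> t; apply/(@cvgrPdist_lt _ _ _ (nbhs t) (nbhs_filter t)) => e e0.
have e0' : 0 < e%:C by rewrite ltcR.
have N : \forall s \near t, `|t - s| < e%:C := near_dist_lt t e0'.
apply: (filterS (F := nbhs t)) N => s ts.
rewrite -ltcR; apply: le_lt_trans ts.
by apply: le_trans (normc_ge_Re _); rewrite raddfB.
Qed.

Lemma continuous_Im : continuous (@complex.Im R : R[i] -> R).
Proof.
move=> t; apply/(@cvgrPdist_lt _ _ _ (nbhs t) (nbhs_filter t)) => e e0.
have e0' : 0 < e%:C by rewrite ltcR.
have N : \forall s \near t, `|t - s| < e%:C := near_dist_lt t e0'.
apply: (filterS (F := nbhs t)) N => s ts.
rewrite -ltcR; apply: le_lt_trans ts.
by apply: le_trans (normc_ge_Im _); rewrite raddfB.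
Qed.

End ComplexTopology.

Section RealDirectionalDerivative.
Variables (R : realType) (n : nat).
Implicit Types (f g : pt R n -> R[i]) (v w p q : pt R n) (W : set (pt R n)).

Lemma line_continuous p v : continuous (fun t : R => p + t%:C *: v).
Proof.
move=> t; apply: cvgD; first exact: cvg_cst.
apply: cvgZr_tmp; exact: continuous_real_complex.
Qed.

Lemma plane_continuous p v w :
  continuous (fun z : R * R => p + z.1%:C *: v + z.2%:C *: w).
Proof.
move=> z; apply: cvgD; first apply: cvgD; first exact: cvg_cst.
- apply: cvgZr_tmp; apply: (@cvg_comp _ _ _ fst (fun x : R => x%:C) _ (nbhs z.1)).
    exact: cvg_fst.
  exact: continuous_real_complex.
- apply: cvgZr_tmp; apply: (@cvg_comp _ _ _ snd (fun x : R => x%:C) _ (nbhs z.2)).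
    exact: cvg_snd.
  exact: continuous_real_complex.
Qed.

Lemma cvg_line0 p v : (fun t : R => p + t%:C *: v) @ (0 : R) --> p.
Proof.
have H : (fun t : R => p + t%:C *: v) @ (0 : R) --> p + (0 : R)%:C *: v.
  exact: line_continuous.
by move: H; rewrite scale0r addr0.
Qed.

Lemma cvg_plane p v w :
  (fun z : R * R => p + z.1%:C *: v + z.2%:C *: w) @ ((0 : R), (0 : R)) --> p.
Proof.
have H0 (u : pt R n) : (fun t : R => t%:C *: u) @ (0 : R) --> (0 : pt R n).
  by have := @cvg_line0 0 u; under eq_fun do rewrite add0r.
have H1 : (fun z : R * R => z.1%:C *: v) @ ((0 : R), (0 : R)) --> (0 : pt R n).
  apply: (@cvg_comp _ _ _ fst (fun x : R => x%:C *: v) _ (nbhs (0 : R))); last exact: H0.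
  exact: cvg_fst.
have H2 : (fun z : R * R => z.2%:C *: w) @ ((0 : R), (0 : R)) --> (0 : pt R n).
  apply: (@cvg_comp _ _ _ snd (fun x : R => x%:C *: w) _ (nbhs (0 : R))); last exact: H0.
  exact: cvg_snd.
have Hp : (fun z : R * R => p) @ ((0 : R), (0 : R)) --> p by exact: cvg_cst.
have E : p + 0 + 0 = p by rewrite (addr0 (p + 0)) (addr0 p).
exact: (@eq_ind _ (p + 0 + 0) (fun q => _ --> q) (cvgD (cvgD Hp H1) H2) p E).
Qed.

Lemma near_line W p v : open W -> W p -> \forall t \near (0 : R), W (p + t%:C *: v).
Proof.
move=> oW Wp; apply: (@line_continuous p v 0 W).
by rewrite /= scale0r addr0; apply: open_nbhs_nbhs.
Qed.

(** Carries derivability together with the value, so that the rules of calculus compose;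
    [rderivableP] and [is_rd_val] translate from and to [rderive]. *)
Definition is_rd f v p (d : R[i]) : Prop :=
  is_derive (0 : R) (1 : R) (fun t : R => complex.Re (f (p + t%:C *: v))) (complex.Re d) /\
  is_derive (0 : R) (1 : R) (fun t : R => complex.Im (f (p + t%:C *: v))) (complex.Im d).

Lemma rderivableP f v p : rderivable f v p -> is_rd f v p (rderive v f p).
Proof.
case=> fr fi; split.
  by apply: (is_derive_eq (derivableP fr)); rewrite -derive1E.
by apply: (is_derive_eq (derivableP fi)); rewrite -derive1E.
Qed.

Lemma is_rd_derivable f v p d : is_rd f v p d -> rderivable f v p.
Proof. by case=> [[fr _] [fi _]]; split; [exact: fr|exact: fi]. Qed.

Lemma is_rd_val f v p d : is_rd f v p d -> rderive v f p = d.
Proof. by rewrite /rderive !derive1E; case: d => a b [[_ /= ->] [_ /= ->]]. Qed.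

Lemma is_rd_near W f g v p d : open W -> W p -> (forall q, W q -> f q = g q) ->
  is_rd f v p d -> is_rd g v p d.
Proof.
move=> oW Wp fg; have N := near_line v oW Wp.
by case=> fr fi; split; [move: fr|move: fi]; apply: near_eq_is_derive;
  apply: filterS N => t /fg ->.
Qed.

Lemma is_rd_eq f v p d d' : d = d' -> is_rd f v p d -> is_rd f v p d'.
Proof. by move=> ->. Qed.

Lemma is_rd_cst c v p : is_rd (fun=> c) v p 0.
Proof. by split; apply: is_derive_cst. Qed.

Lemma complex_ReM (x y : R[i]) : complex.Re (x * y) =
  complex.Re x * complex.Re y - complex.Im x * complex.Im y.
Proof. by case: x y => a b [c d]. Qed.

Lemma complex_ImM (x y : R[i]) : complex.Im (x * y) =
  complex.Re x * complex.Im y + complex.Im x * complex.Re y.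
Proof. by case: x y => a b [c d]. Qed.

Lemma complex_ReD (x y : R[i]) : complex.Re (x + y) = complex.Re x + complex.Re y.
Proof. by case: x y => a b [c d]. Qed.

Lemma complex_ImD (x y : R[i]) : complex.Im (x + y) = complex.Im x + complex.Im y.
Proof. by case: x y => a b [c d]. Qed.

Lemma complex_ReN (x : R[i]) : complex.Re (- x) = - complex.Re x.
Proof. by case: x. Qed.

Lemma complex_ImN (x : R[i]) : complex.Im (- x) = - complex.Im x.
Proof. by case: x. Qed.

Lemma is_rdD f g v p df dg : is_rd f v p df -> is_rd g v p dg ->
  is_rd (fun q => f q + g q) v p (df + dg).
Proof.
move=> [fr fi] [gr gi]; split; rewrite ?complex_ReD ?complex_ImD.
  under eq_fun do rewrite complex_ReD; exact: is_deriveD.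
under eq_fun do rewrite complex_ImD; exact: is_deriveD.
Qed.

Lemma is_rdM f g v p df dg : is_rd f v p df -> is_rd g v p dg ->
  is_rd (fun q => f q * g q) v p (df * g p + f p * dg).
Proof.
move=> [fr fi] [gr gi]; split.
  under eq_fun do rewrite complex_ReM.
  apply: (is_derive_eq (is_deriveB (is_deriveM fr gr) (is_deriveM fi gi))).
  rewrite /= scale0r addr0 complex_ReD !complex_ReM; rewrite /GRing.scale /=; ring.
under eq_fun do rewrite complex_ImM.
apply: (is_derive_eq (is_deriveD (is_deriveM fr gi) (is_deriveM fi gr))).
rewrite /= scale0r addr0 complex_ImD !complex_ImM; rewrite /GRing.scale /=; ring.
Qed.

Lemma is_rd_conj f v p d : is_rd f v p d -> is_rd (fun q => ((f q)^*)%R) v p (d^*)%R.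
Proof.
have rE x : complex.Re (x^*)%R = complex.Re x :> R by case: x.
have iE x : complex.Im (x^*)%R = - complex.Im x :> R by case: x.
move=> [fr fi]; split.
  by under eq_fun do rewrite rE; rewrite rE.
under eq_fun do rewrite iE; rewrite iE; exact: is_deriveN.
Qed.

Lemma is_rdV f v p d : f p != 0 -> is_rd f v p d ->
  is_rd (fun q => (f q)^-1) v p (- d * (f p)^-1 * (f p)^-1).
Proof.
move=> f0 [fr fi].
pose N2 (x : R[i]) := complex.Re x * complex.Re x + complex.Im x * complex.Im x.
have rE (x : R[i]) : complex.Re x^-1 = complex.Re x * (N2 x)^-1.
  by case: x.
have iE (x : R[i]) : complex.Im x^-1 = - (complex.Im x * (N2 x)^-1).
  by case: x => a b; rewrite /= -mulNr.
(* The squared modulus of [f] along the line: the inverse is the conjugate divided by it, which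
   reduces the claim to real quotients. *)
pose N t := complex.Re (f (p + t%:C *: v)) * complex.Re (f (p + t%:C *: v)) +
  complex.Im (f (p + t%:C *: v)) * complex.Im (f (p + t%:C *: v)).
have N0 : N 0 != 0.
  rewrite /N scale0r addr0 -!expr2 paddr_eq0 ?sqr_ge0// !sqrf_eq0.
  by apply: contra f0 => /andP[/eqP a0 /eqP b0]; rewrite eq_complex a0 b0 /= !eqxx.
have dN := is_deriveV N0 (is_deriveD (is_deriveM fr fr) (is_deriveM fi fi)).
have NE : N 0 = complex.Re (f p) * complex.Re (f p) + complex.Im (f p) * complex.Im (f p).
  by rewrite /N scale0r addr0.
split.
  under eq_fun do rewrite rE.
  apply: (is_derive_eq (is_deriveM fr dN)).
  rewrite /= -/(N 0) scale0r addr0.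
  rewrite !(complex_ReM, complex_ImM, rE, iE, complex_ReN, complex_ImN).
  rewrite /N2 -!NE /GRing.scale /=; move: N0; rewrite NE => N0; field.
  exact: N0.
under eq_fun do rewrite iE.
apply: (is_derive_eq (is_deriveN (is_deriveM fi dN))).
rewrite /= -/(N 0) scale0r addr0.
  rewrite !(complex_ReM, complex_ImM, rE, iE, complex_ReN, complex_ImN).
rewrite /N2 -!NE /GRing.scale /=; move: N0; rewrite NE => N0; field.
exact: N0.
Qed.

Lemma is_rd_scale f v p d (c : R) : is_rd f v p d -> is_rd f (c%:C *: v) p (c%:C * d).
Proof.
have cE t : p + t%:C *: (c%:C *: v) = p + (c * t)%:C *: v.
  by rewrite scalerA -rmorphM mulrC.
have dc : is_derive (0 : R) (1 : R) ( *%R c) c.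
  apply: (is_derive_eq (is_deriveZ c (is_derive_id (0:R) (1:R)))).
  by rewrite /GRing.scale /= mulr1.
move=> [fr fi]; split; under eq_fun do rewrite cE.
  have fr' : is_derive (c * 0) (1 : R) (fun t : R => complex.Re (f (p + t%:C *: v)))
    (complex.Re d) by rewrite mulr0.
  by apply: (is_derive_eq (is_derive1_comp fr' dc)); rewrite complex_ReM /= mul0r subr0 mulrC.
have fi' : is_derive (c * 0) (1 : R) (fun t : R => complex.Im (f (p + t%:C *: v)))
  (complex.Im d) by rewrite mulr0.
by apply: (is_derive_eq (is_derive1_comp fi' dc)); rewrite complex_ImM /= mul0r addr0 mulrC.
Qed.

(** [is_rd] differentiates at parameter 0 only, whereas the mean value theorem needs derivatives at
    every parameter of a fixed line. *)
Lemma is_rd_shift f v p (t : R) d : is_rd f v (p + t%:C *: v) d ->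
  is_derive t (1 : R) (fun t : R => complex.Re (f (p + t%:C *: v))) (complex.Re d) /\
  is_derive t (1 : R) (fun t : R => complex.Im (f (p + t%:C *: v))) (complex.Im d).
Proof.
have cE s : p + s%:C *: v = p + t%:C *: v + (s - t)%:C *: v.
  by rewrite rmorphB scalerBl -addrA [t%:C *: v + _]addrC subrK.
have dc : is_derive t (1 : R) (shift (- t)) 1 by exact: is_derive_shift.
move=> [fr fi]; split; under eq_fun do rewrite cE.
  have fr' : is_derive (shift (- t) t) (1 : R)
    (fun s : R => complex.Re (f (p + t%:C *: v + s%:C *: v))) (complex.Re d).
    by rewrite /= subrr.
  by apply: (is_derive_eq (is_derive1_comp fr' dc)); rewrite mulr1.
have fi' : is_derive (shift (- t) t) (1 : R)
  (fun s : R => complex.Im (f (p + t%:C *: v + s%:C *: v))) (complex.Im d).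
  by rewrite /= subrr.
by apply: (is_derive_eq (is_derive1_comp fi' dc)); rewrite mulr1.
Qed.

End RealDirectionalDerivative.

(** * Functions of class [Ck] on an open set *)

Section SmoothFunctions.
Variables (R : realType) (n : nat) (W : set (pt R n)).
Hypothesis W_open : open W.
Implicit Types (f g : pt R n -> R[i]) (v w p q : pt R n).

(** Indexing by a boolean lets one argument serve for the real and the imaginary part. *)
Definition part (b : bool) (x : R[i]) : R := if b then complex.Re x else complex.Im x.

Lemma continuous_part b : continuous (part b).
Proof. by case: b; [exact: continuous_Re | exact: continuous_Im]. Qed.

Lemma part_inj (x y : R[i]) : (forall b, part b x = part b y) -> x = y.
Proof.
move=> xy; have := xy true; have := xy false.
by case: x y {xy} => a b [c d] /= -> ->.
Qed.

Lemma near_plane p v w : W p -> exists2 e : R, 0 < e &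
  forall s t : R, `|s| < e -> `|t| < e -> W (p + s%:C *: v + t%:C *: w).
Proof.
move=> Wp; have := @cvg_plane R n p v w W (open_nbhs_nbhs (conj W_open Wp)).
move=> [[A B]] /= [/nbhs_ballP[a a0 aA] /nbhs_ballP[b b0 bB]] AB.
exists (Num.min a b); first by rewrite lt_min; apply/andP.
move=> s t; rewrite !lt_min => /andP[sa _] /andP[_ tb].
apply: (AB (s, t)); split => /=.
  by apply: aA; rewrite /ball /= sub0r normrN.
by apply: bB; rewrite /ball /= sub0r normrN.
Qed.

Lemma cvg_open f p : {within W, continuous f} -> W p -> f @ p --> f p.
Proof. by rewrite continuous_open_subspace// => cf Wp; apply: cf; rewrite inE. Qed.

Lemma cvg_part_plane b f p v w : {within W, continuous f} -> W p ->
  (fun z : R * R => part b (f (p + z.1%:C *: v + z.2%:C *: w))) @ (0, 0) -->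
  part b (f (p + (0 : R)%:C *: v + (0 : R)%:C *: w)).
Proof.
move=> cf Wp.
have pE : p + (0 : R)%:C *: v + (0 : R)%:C *: w = p by rewrite !scale0r !addr0.
apply: (@cvg_comp _ _ _ (fun z : R * R => f (p + z.1%:C *: v + z.2%:C *: w)) (part b)
   _ (nbhs (f p))); last by rewrite pE; exact: continuous_part.
apply: (@cvg_comp _ _ _ (fun z : R * R => p + z.1%:C *: v + z.2%:C *: w) f
   _ (nbhs p)); last exact: cvg_open.
exact: cvg_plane.
Qed.

Lemma is_derive_part b f v p (t : R) : rderivable f v (p + t%:C *: v) ->
  is_derive t (1 : R) (fun t : R => part b (f (p + t%:C *: v)))
    (part b (rderive v f (p + t%:C *: v))).
Proof. by move=> /rderivableP /is_rd_shift[fr fi]; case: b. Qed.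

Lemma is_rd_part f v p d : (forall b, is_derive (0 : R) (1 : R)
  (fun t : R => part b (f (p + t%:C *: v))) (part b d)) -> is_rd f v p d.
Proof. by move=> h; split; [exact: (h true) | exact: (h false)]. Qed.

(** On the slice [p + s v + t w], the direction [v + w] is the diagonal, so [is_derive_diag]
    applies. *)
Lemma is_rd_add f v w p : W p -> (forall q, W q -> rderivable f v q) ->
  {within W, continuous (rderive v f)} -> rderivable f w p ->
  is_rd f (v + w) p (rderive v f p + rderive w f p).
Proof.
move=> Wp fv cfv fw; have [e e0 eW] := near_plane v w Wp.
apply: is_rd_part => b.
under eq_fun do rewrite scalerDr addrA.
pose h s t := part b (f (p + s%:C *: v + t%:C *: w)).
pose h1 s t := part b (rderive v f (p + s%:C *: v + t%:C *: w)).
have H1 s t : `|s| < e -> `|t| < e -> is_derive s (1 : R) (h ^~ t) (h1 s t).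
  move=> se te; rewrite /h /h1; under eq_fun do rewrite addrAC.
  rewrite addrAC; apply: is_derive_part; rewrite addrAC; apply: fv; exact: eW.
have pE : p + (0 : R)%:C *: v + (0 : R)%:C *: w = p by rewrite !scale0r !addr0.
have H2 : is_derive (0 : R) (1 : R) (h 0)
    (part b (rderive w f (p + (0 : R)%:C *: v + (0 : R)%:C *: w))).
  by apply: is_derive_part; rewrite pE.
have H3 := @is_derive_diag _ h h1 _ _ e0 H1 (@cvg_part_plane b _ p v w cfv Wp) H2.
apply: (is_derive_eq (H3 : is_derive _ _
  (fun t : R => part b (f (p + t%:C *: v + t%:C *: w))) _)).
by rewrite /h1 pE; case: (b); rewrite ?complex_ReD ?complex_ImD.
Qed.

Lemma rderive_swap f v w p : Ck 2 W f -> W p ->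
  rderive v (rderive w f) p = rderive w (rderive v f) p.
Proof.
move=> [cf C2] Wp; have [e e0 eW] := near_plane v w Wp.
have [fv [cfv Cfv]] := C2 v; have [fw [cfw Cfw]] := C2 w.
have [fvw [cfvw _]] := Cfv w; have [fwv [cfwv _]] := Cfw v.
apply: part_inj => b.
pose h s t := part b (f (p + s%:C *: v + t%:C *: w)).
pose h1 s t := part b (rderive v f (p + s%:C *: v + t%:C *: w)).
pose h2 s t := part b (rderive w f (p + s%:C *: v + t%:C *: w)).
pose h12 s t := part b (rderive w (rderive v f) (p + s%:C *: v + t%:C *: w)).
pose h21 s t := part b (rderive v (rderive w f) (p + s%:C *: v + t%:C *: w)).
have H1 s t : `|s| < e -> `|t| < e -> is_derive s (1 : R) (h ^~ t) (h1 s t).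
  move=> se te; rewrite /h /h1; under eq_fun do rewrite addrAC.
  rewrite addrAC; apply: is_derive_part; rewrite addrAC; apply: fv; exact: eW.
have H2 s t : `|s| < e -> `|t| < e -> is_derive t (1 : R) (h s) (h2 s t).
  by move=> se te; apply: is_derive_part; apply: fw; exact: eW.
have H12 s t : `|s| < e -> `|t| < e -> is_derive t (1 : R) (h1 s) (h12 s t).
  by move=> se te; apply: is_derive_part; apply: fvw; exact: eW.
have H21 s t : `|s| < e -> `|t| < e -> is_derive s (1 : R) (h2 ^~ t) (h21 s t).
  move=> se te; rewrite /h2 /h21; under eq_fun do rewrite addrAC.
  rewrite addrAC; apply: is_derive_part; rewrite addrAC; apply: fwv; exact: eW.
have pE : p + (0 : R)%:C *: v + (0 : R)%:C *: w = p by rewrite !scale0r !addr0.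
have E : h12 0 0 = h21 0 0.
  exact: (schwarz e0 H1 H2 H12 H21 (@cvg_part_plane b _ p v w cfvw Wp)
    (@cvg_part_plane b _ p v w cfwv Wp)).
by have := esym E; rewrite /h12 /h21 pE.
Qed.

Lemma rderive_congr f g v p : (forall q, W q -> f q = g q) -> W p ->
  rderive v f p = rderive v g p.
Proof.
move=> fg Wp; have N := near_line v W_open Wp.
by rewrite /rderive !derive1E; congr (_ +i* _); apply: near_eq_derive;
  apply: filterS N => t /fg ->.
Qed.

Lemma continuous_within_congr f g : (forall q, W q -> f q = g q) ->
  {within W, continuous f} -> {within W, continuous g}.
Proof.
by move=> fg; apply: subspace_eq_continuous => q; rewrite inE => /fg.
Qed.

Lemma Ck_congr r f g : (forall q, W q -> f q = g q) -> Ck r W f -> Ck r W g.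
Proof.
elim: r f g => [|r IH] f g fg [cf Cf]; split; try exact: continuous_within_congr cf.
- by [].
- move=> v; have [fv Cfv] := Cf v; split.
    move=> q Wq; apply: (is_rd_derivable (d := rderive v f q)).
    exact: (is_rd_near W_open Wq fg (rderivableP (fv _ Wq))).
  by apply: IH Cfv => q Wq; exact: rderive_congr.
Qed.

(** The product rule leaves one factor undifferentiated; its class has to be lowered before an
    induction hypothesis on [r] applies to it. *)
Lemma Ck_le r f : Ck r.+1 W f -> Ck r W f.
Proof.
elim: r f => [|r IH] f [cf Cf]; split => // v.
by have [fv Cfv] := Cf v; split => //; exact: IH.
Qed.

Lemma Ck_cst r c : Ck r W (fun=> c).
Proof.
elim: r c => [|r IH] c; split => //; try exact: cst_continuous.
all: try by apply: continuous_subspaceT; exact: cst_continuous.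
move=> v; split => [p _|]; first exact: (is_rd_derivable (@is_rd_cst _ _ c v p)).
by apply: Ck_congr (IH 0) => q _; rewrite (is_rd_val (@is_rd_cst _ _ c v q)).
Qed.

Lemma within_cvg f : (forall p, W p -> f @ p --> f p) -> {within W, continuous f}.
Proof. by move=> cf; rewrite continuous_open_subspace// => p; rewrite inE => /cf. Qed.

Lemma Ck_D r f g : Ck r W f -> Ck r W g -> Ck r W (fun q => f q + g q).
Proof.
elim: r f g => [|r IH] f g [cf Cf] [cg Cg]; split.
all: try by apply: within_cvg => p Wp; apply: cvgD; exact: cvg_open.
  by [].
move=> v; have [fv Cfv] := Cf v; have [gv Cgv] := Cg v.
have E q : W q -> is_rd (fun q => f q + g q) v q (rderive v f q + rderive v g q).
  by move=> Wq; apply: is_rdD; apply: rderivableP; [exact: fv | exact: gv].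
split => [q /E|]; first exact: is_rd_derivable.
by apply: Ck_congr (IH _ _ Cfv Cgv) => q /E /is_rd_val.
Qed.

Lemma Ck_M r f g : Ck r W f -> Ck r W g -> Ck r W (fun q => f q * g q).
Proof.
elim: r f g => [|r IH] f g Cf Cg; have [cf Cf'] := Cf; have [cg Cg'] := Cg; split.
all: try by apply: within_cvg => p Wp; apply: cvgM; exact: cvg_open.
  by [].
move=> v; have [fv Cfv] := Cf' v; have [gv Cgv] := Cg' v.
have E q : W q -> is_rd (fun q => f q * g q) v q (rderive v f q * g q + f q * rderive v g q).
  by move=> Wq; apply: is_rdM; apply: rderivableP; [exact: fv | exact: gv].
split => [q /E|]; first exact: is_rd_derivable.
apply: Ck_congr (Ck_D (IH _ _ Cfv (Ck_le Cg)) (IH _ _ (Ck_le Cf) Cgv)).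
by move=> q /E /is_rd_val.
Qed.

Lemma Ck_V r f : (forall q, W q -> f q != 0) -> Ck r W f -> Ck r W (fun q => (f q)^-1).
Proof.
move=> f0; elim: r => [|r IH] Cf; have [cf Cf'] := Cf; split.
all: try by apply: within_cvg => p Wp; apply: cvgV; [exact: f0 | exact: cvg_open].
  by [].
move=> v; have [fv Cfv] := Cf' v.
(* The sign is written as a constant factor so that the derivative is a product of functions covered
   by [Ck_cst] and [Ck_M]. *)
have E q : W q -> is_rd (fun q => (f q)^-1) v q (-1 * (rderive v f q) * (f q)^-1 * (f q)^-1).
  by move=> Wq; rewrite mulN1r; apply: is_rdV; [exact: f0|apply: rderivableP; exact: fv].
split => [q /E|]; first exact: is_rd_derivable.
have CV := IH (Ck_le Cf).
apply: Ck_congr (Ck_M (Ck_M (Ck_M (Ck_cst r (-1)) Cfv) CV) CV).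
by move=> q /E /is_rd_val.
Qed.

End SmoothFunctions.

(** * Wirtinger calculus *)

Section WirtingerCalculus.
Variables (R : realType) (n : nat) (W : set (pt R n)).
Hypothesis W_open : open W.
Implicit Types (f g : pt R n -> R[i]) (v w p q : pt R n) (c : R[i]).

Lemma smooth_congr f g : (forall q, W q -> f q = g q) -> smooth W f -> smooth W g.
Proof. by move=> fg Sf r; apply: (Ck_congr W_open fg). Qed.

Lemma smooth_cst c : smooth W (fun=> c).
Proof. by move=> r; exact: Ck_cst. Qed.

Lemma smoothD f g : smooth W f -> smooth W g -> smooth W (fun q => f q + g q).
Proof. by move=> Sf Sg r; exact: Ck_D. Qed.

Lemma smoothM f g : smooth W f -> smooth W g -> smooth W (fun q => f q * g q).
Proof. by move=> Sf Sg r; exact: Ck_M. Qed.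

Lemma smoothV f : (forall q, W q -> f q != 0) -> smooth W f ->
  smooth W (fun q => (f q)^-1).
Proof. by move=> f0 Sf r; exact: Ck_V. Qed.

Lemma smooth_sum (I : finType) (P : pred I) (F : I -> pt R n -> R[i]) :
  (forall i, smooth W (F i)) -> smooth W (fun q => \sum_(i | P i) F i q).
Proof.
move=> SF; elim: (index_enum I) => [|i s IH].
  by under eq_fun do rewrite big_nil; exact: smooth_cst.
under eq_fun do rewrite big_cons; case: (P i) => //; exact: smoothD.
Qed.

Lemma smooth_prod (I : finType) (P : pred I) (F : I -> pt R n -> R[i]) :
  (forall i, smooth W (F i)) -> smooth W (fun q => \prod_(i | P i) F i q).
Proof.
move=> SF; elim: (index_enum I) => [|i s IH].
  by under eq_fun do rewrite big_nil; exact: smooth_cst.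
under eq_fun do rewrite big_cons; case: (P i) => //; exact: smoothM.
Qed.

Lemma smooth_det m (A : pt R n -> 'M[R[i]]_m) :
  (forall i j, smooth W (fun q => A q i j)) -> smooth W (fun q => \det (A q)).
Proof.
move=> SA; rewrite /determinant.
apply: smooth_sum => s; apply: smoothM; first exact: smooth_cst.
by apply: smooth_prod.
Qed.

(** By Cramer's rule the entries of the inverse are cofactors divided by the determinant. *)
Lemma smooth_invmx m (A : pt R n -> 'M[R[i]]_m) :
  (forall q, W q -> A q \in unitmx) ->
  (forall i j, smooth W (fun q => A q i j)) ->
  forall i j, smooth W (fun q => invmx (A q) i j).
Proof.
move=> uA SA i j.
apply: (@smooth_congr (fun q => (\det (A q))^-1 * ((-1) ^+ (j + i) *
    \det (row' j (col' i (A q)))))).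
  by move=> q Wq; rewrite /invmx uA// !mxE.
apply: smoothM.
  apply: smoothV; last exact: smooth_det.
  by move=> q /uA; rewrite unitmxE unitfE.
apply: smoothM; first exact: smooth_cst.
apply: smooth_det => a b; under eq_fun do rewrite !mxE; exact: SA.
Qed.

Lemma smooth_rderive f v : smooth W f -> smooth W (rderive v f).
Proof. by move=> Sf r; have [_ /(_ v)[]] := Sf r.+1. Qed.

Lemma smooth_rderivable f v p : smooth W f -> W p -> rderivable f v p.
Proof. by move=> Sf Wp; have [_ /(_ v)[fv _]] := Sf 1%N; exact: fv. Qed.

Lemma smooth_is_rd f v p : smooth W f -> W p -> is_rd f v p (rderive v f p).
Proof. by move=> Sf Wp; apply/rderivableP/smooth_rderivable. Qed.

Lemma smooth_continuous f p : smooth W f -> W p -> f @ p --> f p.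
Proof. by move=> /(_ 0%N)[cf _]; exact: cvg_open. Qed.

Lemma is_rd_coord j v p : is_rd (fun q => q.2 0 j) v p (v.2 0 j).
Proof.
have d1 (r s : R) : is_derive (0 : R) (1 : R) (fun t : R => r + t * s) s.
  have h1 : is_derive (0:R) (1:R) (fun t : R => t * s) s.
    apply: (is_derive_eq (is_deriveM (is_derive_id _ _) (is_derive_cst s _ _))).
    by rewrite /= /GRing.scale /= !mulr0 add0r mulr1.
  apply: (is_derive_eq (is_deriveD (is_derive_cst r _ _) h1)).
  by rewrite add0r.
split; under eq_fun do rewrite !mxE.
  by under eq_fun do rewrite complex_ReD complex_ReM /= mul0r subr0.
by under eq_fun do rewrite complex_ImD complex_ImM /= mul0r addr0.
Qed.

Lemma continuous_coord_snd j : continuous (fun q : pt R n => q.2 0 j).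
Proof.
move=> q; apply: (@cvg_comp _ _ _ snd (fun x : 'rV[R[i]]_n => x 0 j) _ (nbhs q.2)).
  exact: cvg_snd.
exact: coord_continuous.
Qed.

Lemma smooth_coord j : smooth W (fun q => q.2 0 j).
Proof.
case=> [|r]; split => //.
all: try by apply: within_cvg => // p _; exact: continuous_coord_snd.
move=> v; split; first by move=> p _; exact: (is_rd_derivable (is_rd_coord j v p)).
apply: (@Ck_congr _ _ _ _ _ (fun=> v.2 0 j)) => //; last exact: Ck_cst.
by move=> q _; rewrite (is_rd_val (is_rd_coord j v q)).
Qed.

Lemma rderiveD f v w p : smooth W f -> W p ->
  rderive (v + w) f p = rderive v f p + rderive w f p.
Proof.
move=> Sf Wp; apply/is_rd_val/(is_rd_add W_open) => //.
- by move=> q; exact: smooth_rderivable.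
- by have [] := smooth_rderive v Sf 0%N.
- exact: smooth_rderivable.
Qed.

Lemma rderiveZ f v p (r : R) : smooth W f -> W p ->
  rderive (r%:C *: v) f p = r%:C * rderive v f p.
Proof. by move=> Sf Wp; apply/is_rd_val/is_rd_scale/smooth_is_rd. Qed.

(* [c = -'i] gives [wirtinger] and [c = 'i] gives [wirtinger_bar]. *)
Definition wd c v f p : R[i] := 2^-1 * (rderive v f p + c * rderive ('i%R *: v) f p).

Lemma wirtingerE v f p : wirtinger v f p = wd (- 'i%R) v f p.
Proof. by rewrite /wirtinger /wd mulNr. Qed.

Lemma wirtinger_barE v f p : wirtinger_bar v f p = wd 'i%R v f p.
Proof. by []. Qed.

Lemma wd_congr c v f g p : (forall q, W q -> f q = g q) -> W p ->
  wd c v f p = wd c v g p.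
Proof. by move=> fg Wp; rewrite /wd !(rderive_congr W_open _ fg Wp). Qed.

Lemma smooth_wd c v f : smooth W f -> smooth W (wd c v f).
Proof.
move=> Sf; apply: smoothM; first exact: smooth_cst.
apply: smoothD; first exact: smooth_rderive.
by apply: smoothM; [exact: smooth_cst | exact: smooth_rderive].
Qed.

Lemma wd_cst c v (a : R[i]) p : wd c v (fun=> a) p = 0.
Proof. by rewrite /wd !(is_rd_val (is_rd_cst a _ _)) mulr0 addr0 mulr0. Qed.

Lemma rderiveDf f g v p : smooth W f -> smooth W g -> W p ->
  rderive v (fun q => f q + g q) p = rderive v f p + rderive v g p.
Proof. by move=> Sf Sg Wp; apply/is_rd_val/is_rdD; exact: smooth_is_rd. Qed.

Lemma rderiveMf f g v p : smooth W f -> smooth W g -> W p ->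
  rderive v (fun q => f q * g q) p = rderive v f p * g p + f p * rderive v g p.
Proof. by move=> Sf Sg Wp; apply/is_rd_val/is_rdM; exact: smooth_is_rd. Qed.

Lemma wdD c v f g p : smooth W f -> smooth W g -> W p ->
  wd c v (fun q => f q + g q) p = wd c v f p + wd c v g p.
Proof. by move=> Sf Sg Wp; rewrite /wd !rderiveDf//; ring. Qed.

Lemma wdM c v f g p : smooth W f -> smooth W g -> W p ->
  wd c v (fun q => f q * g q) p = wd c v f p * g p + f p * wd c v g p.
Proof. by move=> Sf Sg Wp; rewrite /wd !rderiveMf//; ring. Qed.

Lemma wdMl c v (a : R[i]) f p : smooth W f -> W p ->
  wd c v (fun q => a * f q) p = a * wd c v f p.
Proof. by move=> Sf Wp; rewrite wdM ?wd_cst ?mul0r ?add0r//; exact: smooth_cst. Qed.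

Lemma wd_sum c v (I : finType) (F : I -> pt R n -> R[i]) p :
  (forall i, smooth W (F i)) -> W p ->
  wd c v (fun q => \sum_i F i q) p = \sum_i wd c v (F i) p.
Proof.
move=> SF Wp; elim: (index_enum I) => [|i s IH].
  by rewrite big_nil; under eq_fun do rewrite big_nil; exact: wd_cst.
rewrite big_cons -IH; under eq_fun do rewrite big_cons; apply: wdD => //.
elim: s {IH} => [|j s IH].
  by under eq_fun do rewrite big_nil; exact: smooth_cst.
under eq_fun do rewrite big_cons; exact: smoothD.
Qed.

(** Each operator is a combination of two line derivatives with constant coefficients, so four uses
    of [rderive_swap] cover every pair of barred and unbarred derivatives. *)
Lemma wd_swap c v c' v' f p : smooth W f -> W p ->
  wd c v (wd c' v' f) p = wd c' v' (wd c v f) p.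
Proof.
move=> Sf Wp.
have E a u a' u' : wd a u (wd a' u' f) p = 2^-1 * (2^-1 *
    ((rderive u (rderive u' f) p + a' * rderive u (rderive ('i%R *: u') f) p) +
     a * (rderive ('i%R *: u) (rderive u' f) p +
          a' * rderive ('i%R *: u) (rderive ('i%R *: u') f) p))).
  have S1 w := smooth_rderive w Sf.
  have S2 : smooth W (fun q => a' * rderive ('i%R *: u') f q).
    by apply: smoothM => //; exact: smooth_cst.
  have S3 : smooth W (fun q => rderive u' f q + a' * rderive ('i%R *: u') f q).
    exact: smoothD.
  have D w : rderive w (fun q => 2^-1 * (rderive u' f q + a' * rderive ('i%R *: u') f q)) p
      = 2^-1 * (rderive w (rderive u' f) p + a' * rderive w (rderive ('i%R *: u') f) p).
    rewrite rderiveMf//; last exact: smooth_cst.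
    rewrite rderiveDf// rderiveMf//; last exact: smooth_cst.
    by rewrite !(is_rd_val (is_rd_cst _ _ _)) !mul0r !add0r.
  by rewrite /wd !D [a * _]mulrCA -mulrDr.
rewrite !E (@rderive_swap _ _ _ W_open _ v v' _ (Sf 2%N) Wp).
rewrite (@rderive_swap _ _ _ W_open _ ('i%R *: v) v' _ (Sf 2%N) Wp).
rewrite (@rderive_swap _ _ _ W_open _ v ('i%R *: v') _ (Sf 2%N) Wp).
rewrite (@rderive_swap _ _ _ W_open _ ('i%R *: v) ('i%R *: v') _ (Sf 2%N) Wp).
have alg (A B C D : R[i]) : A + c' * B + c * (C + c' * D) = A + c * C + c' * (B + c * D).
  by ring.
by congr (_ * (_ * _)); exact: alg.
Qed.

Lemma wd_conj c v f p : smooth W f -> W p ->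
  wd c v (fun q => ((f q)^*)%R) p = ((wd (c^*)%R v f p)^*)%R.
Proof.
move=> Sf Wp; rewrite /wd !(is_rd_val (is_rd_conj (smooth_is_rd _ Sf Wp))).
by rewrite conjCM conjCD conjCM conjCK fmorphV rmorph_nat.
Qed.

Lemma wdDv c v w f p : smooth W f -> W p ->
  wd c (v + w) f p = wd c v f p + wd c w f p.
Proof.
move=> Sf Wp; rewrite /wd (scalerDr _ v w) (@rderiveD f v w p Sf Wp).
rewrite (@rderiveD f ('i%R *: v) ('i%R *: w) p Sf Wp).
have alg (A B C D : R[i]) : A + B + c * (C + D) = (A + c * C) + (B + c * D) by ring.
by rewrite -mulrDr; congr (_ * _); exact: alg.
Qed.

Lemma rderive0 f p : rderive 0 f p = 0.
Proof.
apply/is_rd_val/(is_rd_eq (d := 0)) => //.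
by split; under eq_fun do rewrite (scaler0 _ _) (addr0 p); exact: is_derive_cst.
Qed.

Lemma wd0v c f p : wd c 0 f p = 0.
Proof. by rewrite /wd (scaler0 _ _) rderive0 mulr0 addr0 mulr0. Qed.

Lemma wd_sumv c (I : finType) (F : I -> pt R n) f p : smooth W f -> W p ->
  wd c (\sum_i F i) f p = \sum_i wd c (F i) f p.
Proof.
move=> Sf Wp; elim: (index_enum I) => [|i s IH]; first by rewrite !big_nil wd0v.
by rewrite !big_cons (@wdDv c (F i) _ f p Sf Wp) IH.
Qed.

Lemma rderive_cscale f v p (l : R[i]) : smooth W f -> W p ->
  rderive (l *: v) f p =
  (complex.Re l)%:C * rderive v f p + (complex.Im l)%:C * rderive ('i%R *: v) f p.
Proof.
move=> Sf Wp.
have E : l *: v = (complex.Re l)%:C *: v + (complex.Im l)%:C *: ('i%R *: v).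
  rewrite [(complex.Im l)%:C *: _]scalerA -[RHS]scalerDl.
  by congr (_ *: _); rewrite [LHS]complexE complexiE [in LHS]mulrC.
rewrite E (@rderiveD f ((complex.Re l)%:C *: v) ((complex.Im l)%:C *: ('i%R *: v)) p Sf Wp).
by rewrite (@rderiveZ f v p _ Sf Wp) (@rderiveZ f ('i%R *: v) p _ Sf Wp).
Qed.

(** The factor is [l] when [c] is [-'i] and the conjugate of [l] when [c] is ['i]: complex linearity
    and antilinearity in the direction. *)
Lemma wdZ f v p (l : R[i]) c : smooth W f -> W p -> c ^+ 2 = - 1 ->
  wd c (l *: v) f p = ((complex.Re l)%:C - c * (complex.Im l)%:C) * wd c v f p.
Proof.
move=> Sf Wp c2.
have E : 'i%R *: (l *: v) = ('i%C * l) *: v by rewrite [LHS]scalerA complexiE.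
rewrite /wd E (@rderive_cscale f v p l Sf Wp) (@rderive_cscale f v p ('i%C * l) Sf Wp).
have -> : complex.Re ('i%C * l) = - complex.Im l by rewrite mulrC ReiNIm.
have -> : complex.Im ('i%C * l) = complex.Re l by rewrite mulrC ImiRe.
have cc : c * c = -1 by rewrite -expr2.
(* The defect of the wanted factorization is a multiple of [1 + c * c], which vanishes. *)
have alg (A B x y : R[i]) : A * x + B * y + c * (- B * x + A * y) =
    (A - c * B) * (x + c * y) + (1 + c * c) * (B * y) by ring.
by rewrite rmorphN mulrCA; congr (_ * _); rewrite [LHS]alg cc addrN mul0r addr0.
Qed.

Lemma wirtingerZ f v p (l : R[i]) : smooth W f -> W p ->
  wirtinger (l *: v) f p = l * wirtinger v f p.
Proof.
move=> Sf Wp; rewrite (wirtingerE (l *: v)) wirtingerE.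
rewrite (@wdZ f v p l _ Sf Wp); last by rewrite sqrrN sqrCi.
by congr (_ * _); rewrite mulNr opprK; rewrite [RHS]complexE complexiE.
Qed.

Lemma wirtinger_barZ f v p (l : R[i]) : smooth W f -> W p ->
  wirtinger_bar (l *: v) f p = (l^*)%R * wirtinger_bar v f p.
Proof.
move=> Sf Wp; rewrite (wirtinger_barE (l *: v)) wirtinger_barE.
rewrite (@wdZ f v p l _ Sf Wp); last by rewrite sqrCi.
congr (_ * _).
rewrite [in RHS](complexE l) complexiE conjCD conjCM conjCi mulNr.
by rewrite !conjCE !conjc_real.
Qed.

End WirtingerCalculus.

(** * Homogeneous functions *)

Section Homogeneity.
Variables (R : realType) (n : nat) (W : set (pt R n)).
Hypothesis W_open : open W.
Hypothesis W_fiber : forall z (eta eta' : 'rV[R[i]]_n),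
  W (z, eta) -> eta' != 0 -> W (z, eta').
Hypothesis W_neq0 : forall p, W p -> p.2 != 0.
Implicit Types (f g : pt R n -> R[i]) (p q : pt R n) (l c : R[i]) (u w : 'rV[R[i]]_n).

Definition scal l p : pt R n := (p.1, l *: p.2).

(** Bidegree under complex scaling of the fibers: [deta] lowers [a] by one, [detab] lowers [b], and
    [dz] changes neither. *)
Definition homog (a b : nat) f : Prop := forall p l, W p -> l != 0 ->
  f (scal l p) = l ^+ a * (l^*)%R ^+ b * f p.

Lemma W_scal p l : W p -> l != 0 -> W (scal l p).
Proof.
case: p => z eta Wp l0; have eta0 := W_neq0 Wp; apply: (W_fiber Wp).
by rewrite scaler_eq0 negb_or l0.
Qed.

Lemma is_rd_line f g (v w p q : pt R n) d :
  (\forall t \near (0 : R), g (q + t%:C *: w) = f (p + t%:C *: v)) ->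
  is_rd g w q d -> is_rd f v p d.
Proof.
move=> fg [gr gi]; split; [move: gr|move: gi]; apply: near_eq_is_derive;
  by apply: filterS fg => t ->.
Qed.

Lemma scal_line l p u w (t : R) :
  scal l (p + t%:C *: (u, w)) = scal l p + t%:C *: (u, l *: w).
Proof.
case: p => z eta; apply: injective_projections; first by [].
transitivity (l *: (eta + t%:C *: w)); first by [].
by rewrite scalerDr !scalerA [l * _]mulrC -scalerA.
Qed.

(** Scaling the fiber by [l] maps the line of direction [(u, w)] through [p] to the line of
    direction [(u, l *: w)] through [scal l p]. *)
Lemma rderive_scal f l k u w p : smooth W f -> l != 0 ->
  (forall q, W q -> f (scal l q) = k * f q) -> W p ->
  rderive (u, l *: w) f (scal l p) = k * rderive (u, w) f p.
Proof.
move=> Sf l0 fk Wp; apply: is_rd_val.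
have E : is_rd (fun q => k * f q) (u, w) p (0 * f p + k * rderive (u, w) f p).
  by apply: is_rdM; [exact: is_rd_cst | exact: smooth_is_rd Sf Wp].
rewrite mul0r add0r in E; apply: is_rd_line E.
have N := near_line (u, w) W_open Wp.
by apply: filterS N => t /fk <-; rewrite scal_line.
Qed.

Lemma wd_scal c f l k u w p : smooth W f -> l != 0 ->
  (forall q, W q -> f (scal l q) = k * f q) -> W p ->
  wd c (u, l *: w) f (scal l p) = k * wd c (u, w) f p.
Proof.
move=> Sf l0 fk Wp; rewrite /wd.
have E1 : 'i%R *: ((u, l *: w) : pt R n) = ('i%R *: u, l *: ('i%R *: w)).
  apply: injective_projections; first by [].
  transitivity ('i%R *: (l *: w)); first by [].
  by rewrite !scalerA mulrC.
have E2 : 'i%R *: ((u, w) : pt R n) = ('i%R *: u, 'i%R *: w) by [].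
rewrite E1 E2 (@rderive_scal f l k u w p Sf l0 fk Wp).
rewrite (@rderive_scal f l k ('i%R *: u) ('i%R *: w) p Sf l0 fk Wp).
by rewrite [c * _]mulrCA -mulrDr mulrCA.
Qed.

Lemma scale_pair0 l w : ((0, l *: w) : pt R n) = l *: ((0, w) : pt R n).
Proof. by apply: injective_projections => //; exact: esym (scaler0 _ l). Qed.

Lemma homog_dz a b f k : smooth W f -> homog a b f -> homog a b (dz k f).
Proof.
move=> Sf hf p l Wp l0.
have E := @wd_scal (- 'i%R) f l _ (delta_mx 0 k) 0 p Sf l0
  (fun q Wq => hf q l Wq l0) Wp.
by rewrite (scaler0 _ l) -!wirtingerE in E.
Qed.

Lemma homog_deta a b f k : smooth W f -> homog a.+1 b f -> homog a b (deta k f).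
Proof.
move=> Sf hf p l Wp l0; have Wlp := W_scal Wp l0.
(* Scaling turns the direction of [deta k] into [l] times itself, so the identity is obtained
   multiplied by [l]; this is where one degree is lost. *)
apply: (mulfI l0); rewrite /deta -(@wirtingerZ _ _ _ W_open f _ _ l Sf Wlp).
rewrite -scale_pair0 !wirtingerE.
rewrite (@wd_scal (- 'i%R) f l _ 0 (delta_mx 0 k) p Sf l0 (fun q Wq => hf q l Wq l0) Wp).
by rewrite exprS !mulrA.
Qed.

Lemma homog_detab a b f k : smooth W f -> homog a b.+1 f -> homog a b (detab k f).
Proof.
move=> Sf hf p l Wp l0; have Wlp := W_scal Wp l0.
have lc0 : (l^*)%R != 0 by rewrite conjC_eq0.
apply: (mulfI lc0); rewrite /detab -(@wirtinger_barZ _ _ _ W_open f _ _ l Sf Wlp).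
rewrite -scale_pair0 !wirtinger_barE.
rewrite (@wd_scal 'i%R f l _ 0 (delta_mx 0 k) p Sf l0 (fun q Wq => hf q l Wq l0) Wp).
by rewrite exprS !mulrA [_ * l ^+ a]mulrC.
Qed.

Lemma homogM a b a' b' f g : homog a b f -> homog a' b' g ->
  homog (a + a') (b + b') (fun q => f q * g q).
Proof. by move=> hf hg p l Wp l0; rewrite hf// hg// !exprD; ring. Qed.

Lemma homog_sum a b (I : finType) (F : I -> pt R n -> R[i]) :
  (forall i, homog a b (F i)) -> homog a b (fun q => \sum_i F i q).
Proof.
move=> hF p l Wp l0; rewrite mulr_sumr; apply: eq_bigr => i _; exact: hF.
Qed.

Lemma homog_cst c : homog 0 0 (fun=> c).
Proof. by move=> p l _ _; rewrite !expr0 !mul1r. Qed.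

Lemma homog_coord j : homog 1 0 (fun q => q.2 0 j).
Proof. by move=> p l _ _; rewrite /= mxE expr1 expr0 mulr1. Qed.

Lemma homog_congr a b f g : (forall q, W q -> f q = g q) ->
  homog a b f -> homog a b g.
Proof.
by move=> fg hf p l Wp l0; rewrite -!fg//; [exact: hf | exact: W_scal].
Qed.

(** The line through [p] in the direction [c *: p.2] stays in the orbit of [p]: its point at time
    [t] is [scal (1 + t%:C * c) p]. Homogeneity thus makes [f] an explicit polynomial in [t] on
    it. *)
Lemma rderive_euler a b f c p : homog a b f -> W p ->
  rderive (0, c *: p.2) f p = (a%:R * c + b%:R * (c^*)%R) * f p.
Proof.
move=> hf Wp; apply: is_rd_val.
have /rV0Pn[j pj] := W_neq0 Wp.
(* On that line [F] equals the scaling factor [1 + t%:C * c]; as a function of the point it can be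
   fed to the product rule [is_rdM]. *)
pose F q : R[i] := q.2 0 j * (p.2 0 j)^-1.
pose v : pt R n := (0, c *: p.2).
have Fp : F p = 1 by rewrite /F divff.
have dF : is_rd F v p c.
  apply: is_rd_eq (is_rdM (is_rd_coord j v p) (is_rd_cst _ v p)).
  by rewrite mulr0 addr0 mxE mulfK.
have FX e : is_rd (fun q => F q ^+ e) v p (e%:R * c).
  elim: e => [|e IH].
    by under eq_fun do rewrite expr0; rewrite mul0r; exact: is_rd_cst.
  under eq_fun do rewrite exprS.
  apply: is_rd_eq (is_rdM dF IH).
  by rewrite Fp expr1n mulr1 mul1r -natr1 mulrDl mul1r addrC.
have FXc e : is_rd (fun q => ((F q ^+ e)^*)%R) v p (e%:R * (c^*)%R).
  by apply: is_rd_eq (is_rd_conj (FX e)); rewrite conjCM rmorph_nat.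
have G : is_rd (fun q => F q ^+ a * ((F q ^+ b)^*)%R * f p) v p
    ((a%:R * c + b%:R * (c^*)%R) * f p).
  apply: is_rd_eq (is_rdM (is_rdM (FX a) (FXc b)) (is_rd_cst (f p) v p)).
  by rewrite Fp !expr1n conjC1 !mulr1 mulr0 addr0 mul1r.
apply: is_rd_line G.
have N := near_line v W_open Wp; apply: filterS N => t.
have -> : p + t%:C *: v = scal (1 + t%:C * c) p.
  apply: injective_projections.
    transitivity (p.1 + t%:C *: 0); first by [].
    by rewrite (scaler0 _ t%:C) addr0.
  transitivity (p.2 + t%:C *: (c *: p.2)); first by [].
  by rewrite scalerA -[X in X + _]scale1r -scalerDl.
move=> Wt.
have t0 : 1 + t%:C * c != 0.
  by apply: contraTneq (W_neq0 Wt) => /= ->; rewrite scale0r eqxx.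
rewrite (hf p _ Wp t0); congr (_ * _).
have -> : F (scal (1 + t%:C * c) p) = 1 + t%:C * c by rewrite /F /= mxE mulfK.
by rewrite rmorphXn.
Qed.

Lemma sum_delta_pair w : ((0, w) : pt R n) = \sum_k w 0 k *: ((0, delta_mx 0 k) : pt R n).
Proof.
rewrite {1}(row_sum_delta w).
have M : {morph (fun x : 'rV[R[i]]_n => (0, x) : pt R n) : x y / x + y}.
  by move=> x y; apply: injective_projections => //; exact: esym (addr0 _).
rewrite (big_morph _ M (erefl _ : (0, 0) = 0 :> pt R n)).
by apply: eq_bigr => k _; rewrite scale_pair0.
Qed.

Lemma wirtinger_vertical f w p : smooth W f -> W p ->
  wirtinger (0, w) f p = \sum_k w 0 k * deta k f p.
Proof.
move=> Sf Wp; rewrite sum_delta_pair wirtingerE (wd_sumv W_open _ _ Sf Wp).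
by apply: eq_bigr => k _; rewrite -wirtingerE (wirtingerZ W_open _ _ Sf Wp).
Qed.

Lemma wirtinger_bar_vertical f w p : smooth W f -> W p ->
  wirtinger_bar (0, w) f p = \sum_k ((w 0 k)^*)%R * detab k f p.
Proof.
move=> Sf Wp; rewrite sum_delta_pair wirtinger_barE (wd_sumv W_open _ _ Sf Wp).
by apply: eq_bigr => k _; rewrite -wirtinger_barE (wirtinger_barZ W_open _ _ Sf Wp).
Qed.

(** The scalar factor is [a%:R] for [c = - 'i] and [b%:R] for [c = 'i]. *)
Lemma wd_euler a b f c p : homog a b f -> W p -> wd c (0, p.2) f p =
  2^-1 * (a%:R + b%:R + c * ('i%R * (a%:R - b%:R))) * f p.
Proof.
move=> hf Wp; rewrite /wd -scale_pair0.
rewrite (rderive_euler 'i%R hf Wp) -{1}(scale1r p.2) (rderive_euler 1 hf Wp).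
rewrite conjC1 conjCi.
have alg (A B I x : R[i]) : (A * 1 + B * 1) * x + c * ((A * I + B * - I) * x) =
   (A + B + c * (I * (A - B))) * x by ring.
by rewrite -mulrA; congr (_ * _); exact: alg.
Qed.

Lemma euler a b f p : smooth W f -> homog a b f -> W p ->
  \sum_k p.2 0 k * deta k f p = a%:R * f p.
Proof.
move=> Sf hf Wp; rewrite -wirtinger_vertical// wirtingerE (wd_euler _ hf Wp).
congr (_ * _); rewrite mulrA mulNr -expr2 sqrCi opprK mul1r.
have -> : a%:R + b%:R + (a%:R - b%:R) = 2 * a%:R :> R[i] by ring.
by rewrite mulKf// pnatr_eq0.
Qed.

End Homogeneity.

(** * A Liouville theorem *)

Section Liouville.
Variables (R : realType) (n : nat) (W : set (pt R n)).
Hypothesis W_open : open W.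
Hypothesis W_fiber : forall z (eta eta' : 'rV[R[i]]_n),
  W (z, eta) -> eta' != 0 -> W (z, eta').
Hypothesis W_neq0 : forall p, W p -> p.2 != 0.
Implicit Types (f g : pt R n -> R[i]) (p q : pt R n) (l c : R[i]) (u w : 'rV[R[i]]_n).

(* Holomorphy along the fibers of T'M. *)
Definition vholo f : Prop := forall p, W p -> forall k, detab k f p = 0.

(** The Cauchy-Riemann equation on the complex line spanned by an arbitrary vertical vector. *)
Lemma vholo_rderive f w p : smooth W f -> vholo f -> W p ->
  rderive (0, 'i%R *: w) f p = 'i%R * rderive (0, w) f p.
Proof.
move=> Sf hf Wp.
have := wirtinger_bar_vertical W_open w Sf Wp.
rewrite big1 => [|k _]; last by rewrite hf// mulr0.
rewrite wirtinger_barE /wd -scale_pair0 => /eqP; rewrite mulf_eq0 invr_eq0 pnatr_eq0 /=.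
rewrite addr_eq0 => /eqP ->.
by rewrite mulrN mulrA -expr2 sqrCi mulN1r opprK.
Qed.

(** Laplace's equation: the Cauchy-Riemann equation is used twice, with a commutation of derivatives
    in between. *)
Lemma vholo_harmonic f w p : smooth W f -> vholo f -> W p ->
  rderive (0, 'i%R *: w) (rderive (0, 'i%R *: w) f) p =
  - rderive (0, w) (rderive (0, w) f) p.
Proof.
move=> Sf hf Wp.
have cM v : rderive v (fun q => 'i%R * rderive (0, w) f q) p =
    'i%R * rderive v (rderive (0, w) f) p.
  rewrite (rderiveMf v (smooth_cst W_open 'i%R) (smooth_rderive (0, w) Sf) Wp).
  by rewrite (is_rd_val (is_rd_cst _ _ _)) mul0r add0r.
have E := fun v => @rderive_congr _ _ _ W_open _ _ v p
  (fun q Wq => @vholo_rderive f w q Sf hf Wq) Wp.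
rewrite E cM (@rderive_swap _ _ _ W_open f _ _ p (Sf 2%N) Wp) E cM.
by rewrite mulrA -expr2 sqrCi mulN1r.
Qed.

(** Serves for the restriction of [Re f + e |t|^2] to a horizontal or vertical line through a
    maximum; the three coefficients come from expanding the square around that point. *)
Lemma quadratic_perturbation_max f v p (c0 c1 c2 e : R) : smooth W f ->
  (forall t : R, W (p + t%:C *: v)) -> 0 < e ->
  (forall t : R, `|t| < e ->
    complex.Re (f (p + t%:C *: v)) + (c0 + c1 * t + c2 * t ^+ 2) <=
    complex.Re (f p) + c0) ->
  complex.Re (rderive v (rderive v f) p) + 2 * c2 <= 0.
Proof.
move=> Sf Wl e0 fmax.
have W0 : W p by have := Wl 0; rewrite scale0r (addr0 p).
have dX (t : R) : is_derive t (1 : R) (fun t : R => c0 + c1 * t + c2 * t ^+ 2)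
    (c1 + 2 * c2 * t).
  apply: is_derive_eq; rewrite /GRing.scale /=; ring.
have dX1 (t : R) : is_derive t (1 : R) (fun t : R => c1 + 2 * c2 * t) (2 * c2).
  apply: is_derive_eq; rewrite /GRing.scale /=; ring.
have D1 (t : R) : is_derive t (1 : R)
    (fun t : R => complex.Re (f (p + t%:C *: v)) + (c0 + c1 * t + c2 * t ^+ 2))
    (complex.Re (rderive v f (p + t%:C *: v)) + (c1 + 2 * c2 * t)).
  apply: is_deriveD (dX t); exact: (is_derive_part true (smooth_rderivable v Sf (Wl t))).
have D2 : is_derive (0 : R) (1 : R)
    (fun t : R => complex.Re (rderive v f (p + t%:C *: v)) + (c1 + 2 * c2 * t))
    (complex.Re (rderive v (rderive v f) p) + 2 * c2).
  apply: is_deriveD (dX1 0).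
  have [D _] := smooth_is_rd v (smooth_rderive v Sf) W0; exact: D.
apply: (second_derivative_max e0 (fun t _ => D1 t) D2) => t te.
apply: (le_trans (fmax t te)).
by rewrite scale0r (addr0 p) mulr0 expr0n mulr0 !addr0.
Qed.

Lemma planeE z u w (x y : R) :
  ((z, u) : pt R n) + x%:C *: ((0, w) : pt R n) + y%:C *: ((0, 'i%R *: w) : pt R n) =
  (z, u + (x +i* y) *: w).
Proof.
apply: injective_projections.
  transitivity (z + x%:C *: 0 + y%:C *: 0); first by [].
  by rewrite (scaler0 _ x%:C) (scaler0 _ y%:C) !addr0.
transitivity (u + x%:C *: w + y%:C *: ('i%R *: w)); first by [].
rewrite scalerA -addrA -scalerDl; congr (_ + _ *: _).
by rewrite [RHS]complexE /= complexiE [y%:C * _]mulrC.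
Qed.

Lemma lineE z u w (t : R) :
  ((z, u) : pt R n) + t%:C *: ((0, w) : pt R n) = (z, u + t%:C *: w).
Proof.
apply: injective_projections; last by [].
transitivity (z + t%:C *: 0); first by [].
by rewrite (scaler0 _ t%:C) addr0.
Qed.

Lemma continuous_plane_Re f z u w (e : R) : smooth W f ->
  (forall l, W (z, u + l *: w)) ->
  continuous (fun s : R * R => complex.Re (f (z, u + (s.1 +i* s.2) *: w)) +
    e * (s.1 ^+ 2 + s.2 ^+ 2)).
Proof.
move=> Sf Wl s; apply: cvgD.
  apply: (@cvg_comp _ _ _ (fun s : R * R => f (z, u + (s.1 +i* s.2) *: w))
    (@complex.Re R) _ (nbhs (f (z, u + (s.1 +i* s.2) *: w)))); last exact: continuous_Re.
  apply: (@cvg_comp _ _ _ (fun s : R * R => (z, u + (s.1 +i* s.2) *: w)) f _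
    (nbhs ((z, u + (s.1 +i* s.2) *: w) : pt R n))); last first.
    exact: (smooth_continuous W_open Sf (Wl _)).
  have := @plane_continuous R n (z, u) (0, w) (0, 'i%R *: w) s.
  by rewrite /continuous_at; under eq_fun do rewrite planeE; rewrite planeE.
apply: cvgM; first exact: cvg_cst.
apply: cvgD; apply: cvgM; first [exact: cvg_fst | exact: cvg_snd].
Qed.

(* Otherwise [Re f (z, u + t w)] is larger at [t = 0] than near infinity, where it
   tends to [Re f (z, w)]. Adding a small multiple of [|t|^2] makes its Laplacian
   positive, yet it would still have an interior maximum on a large square. *)
Lemma vholo_homog0_Re_le f z u w : smooth W f -> vholo f -> homog W 0 0 f ->
  W (z, u) -> w != 0 -> (forall l, u != l *: w) ->
  complex.Re (f (z, u)) <= complex.Re (f (z, w)).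
Proof.
move=> Sf hf hom Wu w0 ulw; rewrite leNgt; apply/negP => lt_wu.
have Wlin l : W (z, u + l *: w).
  by apply: (W_fiber Wu); rewrite addr_eq0 -scaleNr.
have Ww : W (z, w) by exact: (W_fiber Wu).
have Wlin' l : W (z, w + l *: u).
  apply: (W_fiber Wu); have [->|l0] := eqVneq l 0; first by rewrite scale0r addr0.
  apply/eqP => /eqP; rewrite addrC addr_eq0 => /eqP E; have := ulw (- l^-1).
  by rewrite scaleNr -scalerN -E scalerA mulVf// scale1r eqxx.
pose d := complex.Re (f (z, u)) - complex.Re (f (z, w)).
have d0 : 0 < d by rewrite subr_gt0.
have [rho rho0 near_w] : exists2 rho : R, 0 < rho & forall x y : R, `|x| < rho -> `|y| < rho ->
    complex.Re (f (z, w + (x +i* y) *: u)) < complex.Re (f (z, w)) + d / 2.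
  have [cf _] := Sf 0%N.
  have d2 : 0 < d / 2 by rewrite divr_gt0.
  have /cvgrPdist_lt/(_ _ d2) :=
    @cvg_part_plane _ _ _ W_open true f (z, w) (0, u) (0, 'i%R *: u) cf Ww.
  move=> [[A B]] /= [/nbhs_ballP[a a0 aA] /nbhs_ballP[b b0 bB]] AB.
  exists (Num.min a b); first by rewrite lt_min; apply/andP.
  move=> x y; rewrite !lt_min => /andP[xa _] /andP[_ yb].
  have := AB (x, y); rewrite !planeE /=.
  have -> : (0 : R) +i* 0 = 0 by [].
  rewrite scale0r addr0 => /(_ _)/wrap[].
    split; first by apply: aA; rewrite /ball /= sub0r normrN.
    by apply: bB; rewrite /ball /= sub0r normrN.
  by rewrite ltr_distlC => /andP[].
(* Since [r * rho = 2], a complex number with one coordinate of absolute value at least [r] has an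
   inverse of modulus at most [rho / 2], which lies in the neighborhood given by [near_w]. *)
pose r := 2 / rho.
have r0 : 0 < r by rewrite divr_gt0.
have far x y : r <= `|x| \/ r <= `|y| ->
    complex.Re (f (z, u + (x +i* y) *: w)) < complex.Re (f (z, w)) + d / 2.
  move=> rxy; pose N := x ^+ 2 + y ^+ 2.
  have rN : r ^+ 2 <= N.
    case: rxy => h; rewrite /N -(real_normK (num_real x)) -(real_normK (num_real y)).
      by apply: ler_wpDr; rewrite ?sqr_ge0// lerXn2r ?nnegrE// ltW.
    by apply: ler_wpDl; rewrite ?sqr_ge0// lerXn2r ?nnegrE// ltW.
  have N0 : 0 < N by apply: lt_le_trans rN; rewrite exprn_gt0.
  have bnd a : a ^+ 2 <= N -> `|a / N| < rho.
    move=> aN; rewrite normrM normfV (gtr0_norm N0) ltr_pdivrMr//.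
    rewrite -(@ltr_pXn2r _ 2) ?nnegrE ?mulr_ge0 ?(ltW rho0) ?(ltW N0)//.
    rewrite real_normK ?num_real//; apply: le_lt_trans aN _.
    rewrite exprMn [N ^+ 2]expr2 mulrA ltr_pMl//.
    have : rho ^+ 2 * r ^+ 2 <= rho ^+ 2 * N by rewrite ler_pM2l// exprn_gt0.
    have -> : rho ^+ 2 * r ^+ 2 = 4.
      by rewrite -exprMn /r mulrCA divff ?gt_eqF// mulr1 -natrX.
    by apply: lt_le_trans; rewrite ltr1n.
  pose t := x +i* y.
  have t0 : t != 0.
    apply/eqP => -[x0 y0]; move: N0; rewrite /N x0 y0 expr0n /= addr0 ltxx //.
  (* Homogeneity of degree 0 exchanges the behavior at infinity for the behavior near [w]. *)
  have -> : f (z, u + t *: w) = f (z, w + t^-1 *: u).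
    have := hom _ t (Wlin' t^-1) t0; rewrite !expr0 !mul1r => <-; congr f.
    rewrite /scal /=; congr (_, _).
    by rewrite scalerDr scalerA divff// scale1r addrC.
  have -> : t^-1 = (x / N) +i* (- (y / N)) by [].
  apply: near_w; first by apply: bnd; rewrite lerDl sqr_ge0.
  by rewrite normrN; apply: bnd; rewrite lerDr sqr_ge0.
(* On the square [|t|^2] is at most [2 * r ^+ 2], so the perturbation is at most [d / 2], the margin
   left by [far]. *)
pose e := d / (4 * r ^+ 2).
have e0 : 0 < e by rewrite divr_gt0// mulr_gt0// exprn_gt0.
pose g (s : R * R) := complex.Re (f (z, u + (s.1 +i* s.2) *: w)) + e * (s.1 ^+ 2 + s.2 ^+ 2).
have cg : continuous g by exact: continuous_plane_Re.
pose K : set (R * R) := `[- r, r] `*` `[- r, r].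
have K0 : K (0, 0) by split; rewrite /= in_itv /= lerNl oppr0 ltW.
have [[x0 y0]] := @compact_EVT_max _ R g K (ex_intro _ _ K0)
  (compact_setX (@segment_compact R (- r) r) (@segment_compact R (- r) r))
  (continuous_subspaceT cg).
rewrite inE => -[] /=; rewrite !in_itv /= -!ler_norml => x0r y0r gmax.
have {}gmax x y : `|x| <= r -> `|y| <= r -> g (x, y) <= g (x0, y0).
  by move=> xr yr; apply: gmax; rewrite inE; split; rewrite /= in_itv /= -ler_norml.
(* On the boundary [g] is below [Re f (z, w) + d / 2 + d / 2], which is its value at the center. *)
have inside : ~ (r <= `|x0| \/ r <= `|y0|).
  move=> /far lt1; have := gmax 0 0; rewrite normr0 => /(_ (ltW r0) (ltW r0)).
  apply/negP; rewrite -ltNge /g /=.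
  have -> : (0 : R) +i* 0 = 0 by [].
  rewrite scale0r addr0 expr0n /= addr0 mulr0 addr0.
  have : e * (x0 ^+ 2 + y0 ^+ 2) <= d / 2.
    have -> : d / 2 = e * (r ^+ 2 + r ^+ 2).
      rewrite /e; clear -r0; move: r0; clearbody r => r0; field; exact: lt0r_neq0.
    rewrite ler_pM2l// lerD// -[leLHS]real_normK ?num_real// lerXn2r ?nnegrE//.
      exact: ltW.
    exact: ltW.
  move: lt1; rewrite /d; lra.
have x0r' : `|x0| < r by rewrite ltNge; apply/negP => ?; apply: inside; left.
have y0r' : `|y0| < r by rewrite ltNge; apply/negP => ?; apply: inside; right.
pose p0 : pt R n := (z, u + (x0 +i* y0) *: w).
have lx (t : R) : p0 + t%:C *: ((0, w) : pt R n) = (z, u + ((x0 + t) +i* y0) *: w).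
  rewrite lineE -addrA -scalerDl; congr (_, _ + _ *: _).
  by apply/eqP; rewrite eq_complex /= addr0 !eqxx.
have ly (t : R) : p0 + t%:C *: ((0, 'i%R *: w) : pt R n) = (z, u + (x0 +i* (y0 + t)) *: w).
  rewrite lineE -addrA scalerA -scalerDl; congr (_, _ + _ *: _).
  rewrite -complexiE; apply/eqP; rewrite eq_complex /=; apply/andP; split; apply/eqP; ring.
have ex0 : 0 < r - `|x0| by rewrite subr_gt0.
have ey0 : 0 < r - `|y0| by rewrite subr_gt0.
have Hx := @quadratic_perturbation_max f (0, w) p0 (e * (x0 ^+ 2 + y0 ^+ 2))
  (2 * e * x0) e (r - `|x0|) Sf.
have Hy := @quadratic_perturbation_max f (0, 'i%R *: w) p0 (e * (x0 ^+ 2 + y0 ^+ 2))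
  (2 * e * y0) e (r - `|y0|) Sf.
have {}Hx : complex.Re (rderive (0, w) (rderive (0, w) f) p0) + 2 * e <= 0.
  apply: Hx => // t; rewrite lx // => te.
  have := gmax (x0 + t) y0 _ y0r; rewrite /g /= => H.
  apply: le_trans (H _); last first.
    by apply: le_trans (ler_normD _ _) _; rewrite -lerBrDl ltW.
  by rewrite lerD2l le_eqVlt; apply/orP; left; apply/eqP; ring.
have {}Hy : complex.Re (rderive (0, 'i%R *: w) (rderive (0, 'i%R *: w) f) p0) + 2 * e <= 0.
  apply: Hy => // t; rewrite ly // => te.
  have := gmax x0 (y0 + t) x0r; rewrite /g /= => H.
  apply: le_trans (H _); last first.
    by apply: le_trans (ler_normD _ _) _; rewrite -lerBrDl ltW.
  by rewrite lerD2l le_eqVlt; apply/orP; left; apply/eqP; ring.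
(* The two second derivatives are opposite, so adding the inequalities gives [4 * e <= 0]. *)
move: Hy; rewrite (vholo_harmonic _ Sf hf (Wlin _)) complex_ReN.
move: Hx e0; lra.
Qed.

(** For independent vectors the inequality of real parts holds both ways by symmetry, and the
    imaginary part of [f] is the real part of [- 'i * f]. *)
Lemma vholo_homog0_only_z f z u w : smooth W f -> vholo f -> homog W 0 0 f ->
  W (z, u) -> W (z, w) -> f (z, u) = f (z, w).
Proof.
move=> Sf hf hom Wu Ww.
have u0 : u != 0 := W_neq0 Wu; have w0 : w != 0 := W_neq0 Ww.
have [[l E]|nul] := pselect (exists l, u = l *: w).
  have l0 : l != 0 by apply: contraNneq u0 => l0; rewrite E l0 scale0r.
  by have := hom _ _ Ww l0; rewrite !expr0 !mul1r E.
have ulw l : u != l *: w by apply/eqP => E; apply: nul; exists l.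
have wlu l : w != l *: u.
  apply/eqP => E; have l0 : l != 0 by apply: contraNneq w0 => l0; rewrite E l0 scale0r.
  by have := ulw l^-1; rewrite E scalerA mulVf// scale1r eqxx.
have Re_eq g : smooth W g -> vholo g -> homog W 0 0 g ->
    complex.Re (g (z, u)) = complex.Re (g (z, w)).
  by move=> Sg hg homg; apply/eqP; rewrite eq_le !vholo_homog0_Re_le.
have ImE (x : R[i]) : complex.Im x = complex.Re (- 'i%C * x).
  by case: x => a b; rewrite complex_ReM /= oppr0 mul0r sub0r mulN1r opprK.
apply/eqP; rewrite eq_complex Re_eq// eqxx /= !ImE; apply/eqP.
apply: (Re_eq (fun q => - 'i%C * f q)).
- by apply: smoothM => //; exact: smooth_cst.
- move=> p Wp k; rewrite /detab wirtinger_barE (wdMl W_open _ _ _ Sf Wp).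
  by rewrite -wirtinger_barE -/(detab k f p) hf// mulr0.
- by move=> p l Wp l0; rewrite hom// !expr0 !mul1r.
Qed.

End Liouville.

(** * Identities of the Chern-Finsler and Berwald connections *)

Section FinslerIdentities.
Variables (R : realType) (n : nat) (W : set (pt R n)).
Hypothesis W_open : open W.
Hypothesis W_fiber : forall z (eta eta' : 'rV[R[i]]_n),
  W (z, eta) -> eta' != 0 -> W (z, eta').
Hypothesis W_neq0 : forall p, W p -> p.2 != 0.
Implicit Types (f : pt R n -> R[i]) (p q : pt R n) (i j k l m h r : 'I_n).

Lemma dzE k f : dz k f = wd (- 'i%R) (delta_mx 0 k, 0) f.
Proof. by apply/funext => p; rewrite /dz wirtingerE. Qed.

Lemma detaE k f : deta k f = wd (- 'i%R) (0, delta_mx 0 k) f.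
Proof. by apply/funext => p; rewrite /deta wirtingerE. Qed.

Lemma dzbE k f : dzb k f = wd 'i%R (delta_mx 0 k, 0) f.
Proof. by []. Qed.

Lemma detabE k f : detab k f = wd 'i%R (0, delta_mx 0 k) f.
Proof. by []. Qed.

Lemma smooth_dz k f : smooth W f -> smooth W (dz k f).
Proof. by rewrite dzE; exact: smooth_wd. Qed.

Lemma smooth_deta k f : smooth W f -> smooth W (deta k f).
Proof. by rewrite detaE; exact: smooth_wd. Qed.

Lemma smooth_detab k f : smooth W f -> smooth W (detab k f).
Proof. by rewrite detabE; exact: smooth_wd. Qed.

Lemma dz_congr k f f' p : (forall q, W q -> f q = f' q) -> W p ->
  dz k f p = dz k f' p.
Proof. by rewrite !dzE; exact: wd_congr. Qed.

Lemma deta_congr k f f' p : (forall q, W q -> f q = f' q) -> W p ->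
  deta k f p = deta k f' p.
Proof. by rewrite !detaE; exact: wd_congr. Qed.

Lemma detab_congr k f f' p : (forall q, W q -> f q = f' q) -> W p ->
  detab k f p = detab k f' p.
Proof. by rewrite !detabE; exact: wd_congr. Qed.

Lemma deta0 k p : deta k (fun=> 0 : R[i]) p = 0.
Proof. by rewrite detaE wd_cst. Qed.

Lemma detaC k i f p : smooth W f -> W p -> deta k (deta i f) p = deta i (deta k f) p.
Proof. by rewrite !detaE; exact: wd_swap. Qed.

Lemma detabC k i f p : smooth W f -> W p -> detab k (detab i f) p = detab i (detab k f) p.
Proof. by rewrite !detabE; exact: wd_swap. Qed.

Lemma detab_detaC k i f p : smooth W f -> W p -> detab k (deta i f) p = deta i (detab k f) p.
Proof. by rewrite !detaE !detabE; exact: wd_swap. Qed.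

Lemma dz_detaC k i f p : smooth W f -> W p -> dz k (deta i f) p = deta i (dz k f) p.
Proof. by rewrite !detaE !dzE; exact: wd_swap. Qed.

Lemma detab_dzC k i f p : smooth W f -> W p -> detab k (dz i f) p = dz i (detab k f) p.
Proof. by rewrite !detabE !dzE; exact: wd_swap. Qed.

Lemma detaM k f f' p : smooth W f -> smooth W f' -> W p ->
  deta k (fun q => f q * f' q) p = deta k f p * f' p + f p * deta k f' p.
Proof. by rewrite !detaE; exact: wdM. Qed.

Lemma detabM k f f' p : smooth W f -> smooth W f' -> W p ->
  detab k (fun q => f q * f' q) p = detab k f p * f' p + f p * detab k f' p.
Proof. by rewrite !detabE; exact: wdM. Qed.

Lemma detaMl k (a : R[i]) f p : smooth W f -> W p ->
  deta k (fun q => a * f q) p = a * deta k f p.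
Proof. by rewrite !detaE; exact: wdMl. Qed.

Lemma detabMl k (a : R[i]) f p : smooth W f -> W p ->
  detab k (fun q => a * f q) p = a * detab k f p.
Proof. by rewrite !detabE; exact: wdMl. Qed.

Lemma deta_sum k (F : 'I_n -> pt R n -> R[i]) p : (forall i, smooth W (F i)) -> W p ->
  deta k (fun q => \sum_i F i q) p = \sum_i deta k (F i) p.
Proof.
by move=> SF Wp; rewrite detaE (wd_sum W_open _ _ SF Wp); under [RHS]eq_bigr do rewrite detaE.
Qed.

Lemma detab_sum k (F : 'I_n -> pt R n -> R[i]) p : (forall i, smooth W (F i)) -> W p ->
  detab k (fun q => \sum_i F i q) p = \sum_i detab k (F i) p.
Proof. by rewrite detabE; exact: wd_sum. Qed.

Lemma conj_deta k f p : smooth W f -> W p ->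
  ((deta k f p)^*)%R = detab k (fun q => ((f q)^*)%R) p.
Proof.
by move=> Sf Wp; rewrite detaE detabE (wd_conj _ _ Sf Wp) conjCi.
Qed.

Lemma conj_detab k f p : smooth W f -> W p ->
  ((detab k f p)^*)%R = deta k (fun q => ((f q)^*)%R) p.
Proof.
by move=> Sf Wp; rewrite detaE detabE (wd_conj _ _ Sf Wp) conjCN conjCi opprK.
Qed.

Lemma conj_dz k f p : smooth W f -> W p ->
  ((dz k f p)^*)%R = dzb k (fun q => ((f q)^*)%R) p.
Proof.
by move=> Sf Wp; rewrite dzE dzbE (wd_conj _ _ Sf Wp) conjCi.
Qed.

Lemma rderive_coord v j p : rderive v (fun q => q.2 0 j) p = v.2 0 j.
Proof. exact: (is_rd_val (is_rd_coord j v p)). Qed.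

Lemma deta_coord k j p : deta k (fun q => q.2 0 j) p = (j == k)%:R.
Proof.
rewrite detaE /wd !rderive_coord !mxE /= mulrA mulNr -expr2 sqrCi opprK mul1r.
have half (x : R[i]) : 2^-1 * (x + x) = x by field.
exact: half.
Qed.

Lemma detab_coord k j p : detab k (fun q => q.2 0 j) p = 0.
Proof.
by rewrite detabE /wd !rderive_coord !mxE /= mulrA -expr2 sqrCi mulN1r subrr mulr0.
Qed.

(** Euler's identity differentiated along the conjugate of eta. It is needed for the spray, of
    bidegree (2, 0): its barred derivative has bidegree (2, -1), which [homog] cannot express. *)
Lemma euler_detab a b f k p : smooth W f -> homog W a b f -> W p ->
  \sum_j p.2 0 j * deta j (detab k f) p = a%:R * detab k f p.
Proof.
move=> Sf hf Wp.
have E q : W q -> \sum_j q.2 0 j * deta j f q = a%:R * f q.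
  exact: (euler W_open W_neq0 Sf hf).
have Sc j : smooth W (fun q => q.2 0 j) by exact: smooth_coord.
have Sd j : smooth W (deta j f) by exact: smooth_deta.
have SM j : smooth W (fun q => q.2 0 j * deta j f q) by exact: smoothM.
rewrite -(detabMl k a%:R Sf Wp) -(detab_congr k E Wp) (detab_sum k SM Wp).
apply: eq_bigr => j _; rewrite (detabM k (Sc j) (Sd j) Wp) detab_coord.
by rewrite mul0r add0r (detab_detaC k j Sf Wp).
Qed.

Lemma only_z_detab f k p :
  (forall z eta eta', W (z, eta) -> W (z, eta') -> f (z, eta) = f (z, eta')) ->
  W p -> detab k f p = 0.
Proof.
move=> fz Wp.
have D0 (w : 'rV[R[i]]_n) : rderive (0, w) f p = 0.
  apply: is_rd_val; apply: is_rd_line (is_rd_cst (f p) (0, w) p).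
  have N := near_line (0, w) W_open Wp; apply: filterS N => t.
  case: p Wp => z eta Wp; rewrite lineE => Wt; exact: fz.
by rewrite detabE /wd -scale_pair0 !D0 mulr0 addr0 mulr0.
Qed.

(* Otherwise conversion tests between two derivatives unfold them to limits. *)
Local Opaque dz dzb deta detab.

Lemma sum_delta (X : 'I_n -> R[i]) k : \sum_j X j * (j == k)%:R = X k.
Proof.
rewrite (bigD1 k) //= eqxx mulr1 big1 ?addr0// => j /negbTE ->.
by rewrite mulr0.
Qed.

(** * The metric tensor, the Chern-Finsler coefficients and the spray *)

Variable L : pt R n -> R[i].
Hypothesis L_smooth : smooth W L.
Hypothesis L_homog : homog W 1 1 L.
Hypothesis L_real : forall p, W p -> ((L p)^*)%R = L p.
Hypothesis g_unit : forall p, W p -> gmx L p \in unitmx.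

Let Lb m := detab m L.
Let g := gten L.
Let N := cfN L.
Let G := spray L.

Lemma smooth_Lb m : smooth W (Lb m).
Proof. exact: smooth_detab. Qed.

Lemma smooth_gten i j : smooth W (g i j).
Proof. exact/smooth_deta/smooth_detab. Qed.

Lemma homog_Lb m : homog W 1 0 (Lb m).
Proof. exact: (homog_detab W_open W_fiber W_neq0). Qed.

Lemma homog_gten i j : homog W 0 0 (g i j).
Proof.
by apply: (homog_deta W_open W_fiber W_neq0); [exact: smooth_Lb | exact: homog_Lb].
Qed.

Lemma deta_gten_sym j l m p : W p -> deta j (g l m) p = deta l (g j m) p.
Proof.
move=> Wp; exact: (detaC j l (smooth_Lb m) Wp).
Qed.

Lemma detab_gten_sym k i r p : W p -> detab k (g i r) p = detab r (g i k) p.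
Proof.
move=> Wp; rewrite /g /gten (detab_detaC k i (smooth_Lb r) Wp).
rewrite (detab_detaC r i (smooth_Lb k) Wp); apply: (deta_congr _ _ Wp) => q Wq.
exact: detabC.
Qed.

Lemma eta_deta_gten j m p : W p -> \sum_l p.2 0 l * deta j (g l m) p = 0.
Proof.
move=> Wp; under eq_bigr do rewrite (deta_gten_sym _ _ _ Wp).
by rewrite (euler W_open W_neq0 (smooth_gten j m) (homog_gten j m) Wp) mul0r.
Qed.

Lemma dz_gten k j m p : W p -> dz k (g j m) p = deta j (dz k (Lb m)) p.
Proof.
by move=> Wp; exact: (dz_detaC k j (smooth_Lb m) Wp).
Qed.

(** Euler's identity in degree 1. It reduces the double sum defining [cfN] to the single sum of
    [cfNE]. *)
Lemma eta_dz_gten k m p : W p -> \sum_l p.2 0 l * dz k (g l m) p = dz k (Lb m) p.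
Proof.
move=> Wp; under eq_bigr do rewrite (dz_gten _ _ _ Wp).
rewrite (euler W_open W_neq0 (smooth_dz k (smooth_Lb m))
  (homog_dz W_open k (smooth_Lb m) (homog_Lb m)) Wp).
by rewrite mul1r.
Qed.

Lemma gten_conj i j p : W p -> ((g i j p)^*)%R = g j i p.
Proof.
move=> Wp; rewrite /g /gten (conj_deta _ (smooth_detab _ L_smooth) Wp).
have E q : W q -> ((detab j L q)^*)%R = deta j L q.
  by move=> Wq; rewrite (conj_detab _ L_smooth Wq); exact: (deta_congr _ L_real Wq).
by rewrite (detab_congr i E Wp) (detab_detaC i j L_smooth Wp).
Qed.

Lemma ginv_gten (X : 'I_n -> R[i]) m p : W p ->
  \sum_i g i m p * (\sum_r ginv L r i p * X r) = X m.
Proof.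
move=> Wp; under eq_bigr do rewrite mulr_sumr.
rewrite exchange_big /= (bigD1 m) //= [X in _ + X]big1 ?addr0 => [|r rm].
  have := mulVmx (g_unit Wp) => /matrixP /(_ m m); rewrite !mxE eqxx => E.
  rewrite -[RHS]mul1r -[X in _ = X * _]E mulr_suml.
  by apply: eq_bigr => i _; rewrite !mxE mulrA [g _ _ _ * _]mulrC.
have := mulVmx (g_unit Wp) => /matrixP /(_ r m); rewrite !mxE (negbTE rm) => E.
rewrite -[RHS](mul0r (X r)) -[X in _ = X * _]E mulr_suml.
by apply: eq_bigr => i _; rewrite !mxE mulrA [g _ _ _ * _]mulrC.
Qed.

Lemma gten_ginv (X : 'I_n -> R[i]) i p : W p ->
  \sum_m ginv L m i p * (\sum_k g k m p * X k) = X i.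
Proof.
move=> Wp; under eq_bigr do rewrite mulr_sumr.
rewrite exchange_big /= (bigD1 i) //= [X in _ + X]big1 ?addr0 => [|k ki].
  have := mulmxV (g_unit Wp) => /matrixP /(_ i i); rewrite !mxE eqxx => E.
  rewrite -[RHS]mul1r -[X in _ = X * _]E mulr_suml.
  by apply: eq_bigr => m _; rewrite !mxE mulrA [ginv _ _ _ _ * _]mulrC.
have := mulmxV (g_unit Wp) => /matrixP /(_ k i); rewrite !mxE (negbTE ki) => E.
rewrite -[RHS](mul0r (X k)) -[X in _ = X * _]E mulr_suml.
by apply: eq_bigr => m _; rewrite !mxE mulrA [ginv _ _ _ _ * _]mulrC.
Qed.

(** Nondegeneracy of the metric tensor, in the form that lets identities be proved with a lowered
    index. *)
Lemma gten_inj (X Y : 'I_n -> R[i]) p : W p ->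
  (forall m, \sum_i g i m p * X i = \sum_i g i m p * Y i) -> forall i, X i = Y i.
Proof.
move=> Wp XY i; rewrite -(gten_ginv X i Wp) -(gten_ginv Y i Wp).
by apply: eq_bigr => m _; rewrite XY.
Qed.

Lemma smooth_ginv m i : smooth W (ginv L m i).
Proof.
apply: (smooth_invmx W_open (A := gmx L)) => // k l.
by rewrite /gmx; under eq_fun do rewrite mxE; exact: smooth_gten.
Qed.

Lemma homog_ginv m i : homog W 0 0 (ginv L m i).
Proof.
move=> p l Wp l0; rewrite !expr0 !mul1r.
have E : gmx L (scal l p) = gmx L p.
  apply/matrixP => a b; rewrite [LHS]mxE [RHS]mxE.
  by have := homog_gten a b Wp l0; rewrite !expr0 !mul1r.
by rewrite /ginv E.
Qed.

Lemma cfNE i j p : W p -> N i j p = \sum_m ginv L m i p * dz j (Lb m) p.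
Proof.
move=> Wp; apply: eq_bigr => m _; rewrite -(eta_dz_gten _ _ Wp) mulr_sumr.
by apply: eq_bigr => l _; rewrite -mulrA [_ * p.2 0 l]mulrC.
Qed.

Lemma smooth_cfN i j : smooth W (N i j).
Proof.
apply: (smooth_congr W_open (fun q Wq => esym (cfNE i j Wq))).
apply: (smooth_sum W_open) => m; apply: (smoothM W_open (smooth_ginv m i)).
exact/smooth_dz/smooth_Lb.
Qed.

Lemma homog_cfN i j : homog W 1 0 (N i j).
Proof.
apply: (homog_congr W_fiber W_neq0 (fun q Wq => esym (cfNE i j Wq))).
apply: homog_sum => m; apply: (homogM (homog_ginv m i)).
exact: (homog_dz W_open _ (smooth_Lb m) (homog_Lb m)).
Qed.

Lemma gten_cfN m j p : W p -> \sum_i g i m p * N i j p = dz j (Lb m) p.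
Proof.
move=> Wp; under eq_bigr do rewrite (cfNE _ _ Wp).
exact: (ginv_gten (fun r => dz j (Lb r) p) m Wp).
Qed.

Lemma gten_cfL m j k p : W p ->
  \sum_i g i m p * cfL L i j k p = hderive N k (g j m) p.
Proof.
by move=> Wp; exact: (ginv_gten (fun l => hderive N k (g j l) p) m Wp).
Qed.

(** Differentiate the lowered form [gten_cfN] of [N] along eta^j: since [deta j (g l m)] is
    symmetric in [j] and [l], the term where [g] is differentiated is the vertical correction in
    [hderive N k (g j m)]. *)
Lemma cfLE i j k p : W p -> cfL L i j k p = deta j (N i k) p.
Proof.
move=> Wp; apply: (gten_inj (X := fun i => cfL L i j k p)
  (Y := fun i => deta j (N i k) p) Wp) => m.
rewrite (gten_cfL _ _ _ Wp) /hderive (dz_gten _ _ _ Wp).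
have E q : W q -> \sum_i g i m q * N i k q = dz k (Lb m) q by exact: gten_cfN.
have SM a : smooth W (fun q => g a m q * N a k q).
  exact: (smoothM W_open (smooth_gten a m) (smooth_cfN a k)).
rewrite -(deta_congr j E Wp) (deta_sum j SM Wp).
apply/eqP; rewrite subr_eq -big_split /=; apply/eqP; apply: eq_bigr => a _.
rewrite (detaM j (smooth_gten a m) (smooth_cfN a k) Wp) addrC; congr (_ + _).
by rewrite (deta_gten_sym _ _ _ Wp) mulrC.
Qed.

Lemma smooth_cfL i j k : smooth W (cfL L i j k).
Proof.
apply: (smooth_congr W_open (fun q Wq => esym (cfLE i j k Wq))).
exact/smooth_deta/smooth_cfN.
Qed.

Lemma homog_cfL i j k : homog W 0 0 (cfL L i j k).
Proof.
apply: (homog_congr W_fiber W_neq0 (fun q Wq => esym (cfLE i j k Wq))).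
exact: (homog_deta W_open W_fiber W_neq0 _ (smooth_cfN i k) (homog_cfN i k)).
Qed.

Lemma eta_cfL i k p : W p -> \sum_j p.2 0 j * cfL L i j k p = N i k p.
Proof.
move=> Wp; under eq_bigr do rewrite (cfLE _ _ _ Wp).
by rewrite (euler W_open W_neq0 (smooth_cfN i k) (homog_cfN i k) Wp) mul1r.
Qed.

Lemma smooth_spray i : smooth W (G i).
Proof.
apply: (smoothM W_open); first exact: smooth_cst.
apply: (smooth_sum W_open) => j.
by apply: (smoothM W_open (smooth_cfN i j)); exact: smooth_coord.
Qed.

Lemma homog_spray i : homog W 2 0 (G i).
Proof.
apply: (homogM (@homog_cst R n W 2^-1)); apply: homog_sum => j.
exact: (homogM (homog_cfN i j) (@homog_coord R n W j)).
Qed.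

Lemma smooth_cN i j : smooth W (cN L i j).
Proof. exact/smooth_deta/smooth_spray. Qed.

Lemma homog_cN i j : homog W 1 0 (cN L i j).
Proof. exact: (homog_deta W_open W_fiber W_neq0 _ (smooth_spray i) (homog_spray i)). Qed.

(** Both sides are twice the spray, one by Euler's identity in degree 2 and the other by
    definition. *)
Lemma eta_cN i p : W p -> \sum_r p.2 0 r * cN L i r p = \sum_r p.2 0 r * N i r p.
Proof.
move=> Wp; rewrite (euler W_open W_neq0 (smooth_spray i) (homog_spray i) Wp).
rewrite /G /spray mulrA divff ?pnatr_eq0// mul1r.
by apply: eq_bigr => r _; rewrite mulrC.
Qed.

Lemma cNE i k p : W p ->
  cN L i k p = 2^-1 * (\sum_j p.2 0 j * cfL L i k j p + N i k p).
Proof.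
move=> Wp; have Sc j : smooth W (fun q => q.2 0 j) by exact: smooth_coord.
have SM j : smooth W (fun q => N i j q * q.2 0 j).
  exact: (smoothM W_open (smooth_cfN i j) (Sc j)).
rewrite /cN (detaMl k 2^-1 (smooth_sum W_open _ SM) Wp); congr (_ * _).
rewrite (deta_sum k SM Wp).
transitivity (\sum_j (p.2 0 j * cfL L i k j p + N i j p * (j == k)%:R)).
  apply: eq_bigr => j _; rewrite (detaM k (smooth_cfN i j) (Sc j) Wp).
  by rewrite deta_coord (cfLE _ _ _ Wp) mulrC.
rewrite big_split /=; congr (_ + _).
exact: (sum_delta (fun j => N i j p) k).
Qed.

Lemma torsion_cfN i k p : W p ->
  \sum_j torsion L i j k p * p.2 0 j = N i k p - \sum_j p.2 0 j * cfL L i k j p.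
Proof.
move=> Wp; rewrite -(eta_cfL _ _ Wp) -sumrB; apply: eq_bigr => j _.
have alg (a b c : R[i]) : (a - b) * c = c * a - c * b by ring.
exact: alg.
Qed.

Lemma torsion_cN i k p : W p ->
  \sum_j torsion L i j k p * p.2 0 j = 2 * (N i k p - cN L i k p).
Proof.
move=> Wp; rewrite (torsion_cfN _ _ Wp) (cNE _ _ Wp).
have alg (x y : R[i]) : x - y = 2 * (x - 2^-1 * (y + x)) by field.
exact: alg.
Qed.

(** * The implications over an open set *)

Definition kahler_on := forall p, W p ->
  forall i k, \sum_j torsion L i j k p * p.2 0 j = 0.

Definition spray_holo_on := forall p, W p -> forall i k, detab k (spray L i) p = 0.

Lemma kahler_cN : kahler_on <-> forall p, W p -> forall i k, cN L i k p = N i k p.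
Proof.
split=> H p Wp i k; last by rewrite (torsion_cN _ _ Wp) H// subrr mulr0.
have := H p Wp i k; rewrite (torsion_cN _ _ Wp) => /eqP.
by rewrite mulf_eq0 pnatr_eq0 /= subr_eq0 => /eqP ->.
Qed.

Lemma BL_sym i j k p : W p -> BL L i j k p = BL L i k j p.
Proof.
by move=> Wp; exact: (detaC k j (smooth_spray i) Wp).
Qed.

(** The lower indices of [BL] are exchanged first, because [cfL] differentiates [N] along the first
    of them. *)
Lemma kahler_BL i j k p : kahler_on -> W p -> BL L i j k p = cfL L i j k p.
Proof.
move=> /kahler_cN K Wp; rewrite (BL_sym _ _ _ Wp) (cfLE _ _ _ Wp).
by apply: (deta_congr _ _ Wp) => q Wq; exact: K.
Qed.

Lemma BLbE i j k p : W p -> BLb L i j k p = deta j (detab k (G i)) p.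
Proof.
by move=> Wp; exact: (detab_detaC k j (smooth_spray i) Wp).
Qed.

Lemma holo_BLb i j k p : spray_holo_on -> W p -> BLb L i j k p = 0.
Proof.
move=> H Wp; rewrite (BLbE _ _ _ Wp) -[RHS](deta0 j p).
by apply: (deta_congr _ _ Wp) => q Wq; exact: H.
Qed.

Lemma kahler_cfL_only_z i j k z eta eta' : kahler_on -> spray_holo_on ->
  W (z, eta) -> W (z, eta') -> cfL L i j k (z, eta) = cfL L i j k (z, eta').
Proof.
move=> K H; apply: (vholo_homog0_only_z W_open W_fiber W_neq0 (smooth_cfL i j k)).
  move=> p Wp h.
  have E q : W q -> cfL L i j k q = BL L i j k q.
    by move=> Wq; rewrite kahler_BL.
  rewrite (detab_congr h E Wp) (detab_detaC h k (smooth_cN i j) Wp) -(deta0 k p).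
  by apply: (deta_congr _ _ Wp) => q Wq; exact: (holo_BLb i j h H Wq).
exact: homog_cfL.
Qed.

(** The spray is then a quadratic polynomial in eta, [2^-1 * L^i_{jk}(z) eta^j eta^k]. *)
Lemma only_z_spray_holo :
  (forall i j k z eta eta', W (z, eta) -> W (z, eta') ->
    cfL L i j k (z, eta) = cfL L i j k (z, eta')) -> spray_holo_on.
Proof.
move=> Hz p Wp i h.
have Sc j : smooth W (fun q => q.2 0 j) by exact: smooth_coord.
have E q : W q -> G i q =
    2^-1 * \sum_k (\sum_j q.2 0 j * cfL L i j k q) * q.2 0 k.
  move=> Wq; congr (_ * _); apply: eq_bigr => k _; congr (_ * _).
  by rewrite (eta_cfL _ _ Wq).
have S1 j k : smooth W (fun q => q.2 0 j * cfL L i j k q).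
  exact: (smoothM W_open (Sc j) (smooth_cfL i j k)).
have S2 k : smooth W (fun q => \sum_j q.2 0 j * cfL L i j k q).
  exact: (smooth_sum W_open _ (S1 ^~ k)).
have S3 k : smooth W (fun q => (\sum_j q.2 0 j * cfL L i j k q) * q.2 0 k).
  exact: (smoothM W_open (S2 k) (Sc k)).
rewrite (detab_congr h E Wp) (detabMl h 2^-1 (smooth_sum W_open _ S3) Wp).
rewrite (detab_sum h S3 Wp) big1 ?mulr0// => k _.
rewrite (detabM h (S2 k) (Sc k) Wp) detab_coord mulr0 addr0.
rewrite (detab_sum h (S1 ^~ k) Wp) big1 ?mul0r// => j _.
rewrite (detabM h (Sc j) (smooth_cfL i j k) Wp) detab_coord mul0r add0r.
by rewrite (only_z_detab _ (Hz i j k) Wp) mulr0.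
Qed.

Lemma hderive_bar_gten M k j r p : W p ->
  hderive_bar M k (g j r) p = ((hderive M k (g r j) p)^*)%R.
Proof.
move=> Wp; rewrite /hderive_bar /hderive conjCD conjCN conjC_sum.
have E q : W q -> ((g r j q)^*)%R = g j r q by move=> Wq; exact: gten_conj.
congr (_ - _).
  by rewrite (conj_dz _ (smooth_gten r j) Wp) !dzbE; exact/esym/(wd_congr W_open _ _ E Wp).
apply: eq_bigr => a _; rewrite conjCM (conj_deta _ (smooth_gten r j) Wp); congr (_ * _).
exact/esym/(detab_congr a E Wp).
Qed.

(** The vertical correction dies by [eta_deta_gten], so this contraction does not see the nonlinear
    connection; the results for [cN] and for [N] can be compared through it. *)
Lemma eta_hderive M k j p : W p ->
  \sum_r p.2 0 r * hderive M k (g r j) p = dz k (Lb j) p.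
Proof.
move=> Wp; rewrite /hderive; under eq_bigr do rewrite mulrBr mulr_sumr.
rewrite sumrB (eta_dz_gten _ _ Wp) exchange_big /= big1 ?subr0// => a _.
under eq_bigr do rewrite mulrCA.
by rewrite -mulr_sumr (eta_deta_gten _ _ Wp) mulr0.
Qed.

(** Differentiate the lowered formula for the spray along the conjugate of eta^k: the second barred
    derivatives of [L] and the term containing [detab k (g i r)] are both symmetric in [r] and [k],
    hence so is the remaining one. *)
Lemma gten_detab_spray_sym r k p : W p ->
  \sum_i g i r p * detab k (G i) p = \sum_i g i k p * detab r (G i) p.
Proof.
have Sc j : smooth W (fun q => q.2 0 j) by exact: smooth_coord.
have E a q : W q -> \sum_i g i a q * G i q = 2^-1 * \sum_j q.2 0 j * dz j (Lb a) q.
  move=> Wq; transitivity (2^-1 * \sum_i \sum_j q.2 0 j * (g i a q * N i j q)).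
    rewrite mulr_sumr; apply: eq_bigr => i _; rewrite mulrCA; congr (_ * _).
    by rewrite mulr_sumr; apply: eq_bigr => j _; rewrite [RHS]mulrC mulrA.
  rewrite exchange_big /=; congr (_ * _); apply: eq_bigr => j _.
  by rewrite -mulr_sumr (gten_cfN _ _ Wq).
have SM i a : smooth W (fun q => g i a q * G i q).
  exact: (smoothM W_open (smooth_gten i a) (smooth_spray i)).
have S1 j a : smooth W (fun q => q.2 0 j * dz j (Lb a) q).
  exact: (smoothM W_open (Sc j) (smooth_dz j (smooth_Lb a))).
move=> Wp.
have D a b : \sum_i g i a p * detab b (G i) p =
    2^-1 * (\sum_j p.2 0 j * detab b (dz j (Lb a)) p) - \sum_i detab b (g i a) p * G i p.
  have := detab_congr b (E a) Wp.
  rewrite (detab_sum b (SM ^~ a) Wp) (detabMl b 2^-1 (smooth_sum W_open _ (S1 ^~ a)) Wp).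
  rewrite (detab_sum b (S1 ^~ a) Wp) => H.
  apply/eqP; rewrite eq_sym subr_eq eq_sym -big_split /=; apply/eqP.
  transitivity (2^-1 * (\sum_j detab b (fun q => q.2 0 j * dz j (Lb a) q) p)).
    rewrite -H; apply: eq_bigr => i _.
    by rewrite (detabM b (smooth_gten i a) (smooth_spray i) Wp) addrC.
  congr (_ * _); apply: eq_bigr => j _.
  by rewrite (detabM b (Sc j) (smooth_dz j (smooth_Lb a)) Wp) detab_coord mul0r add0r.
have Ej j : detab k (dz j (Lb r)) p = detab r (dz j (Lb k)) p.
  rewrite (detab_dzC k j (smooth_Lb r) Wp) (detab_dzC r j (smooth_Lb k) Wp).
  by apply: (dz_congr _ _ Wp) => q Wq; exact: detabC.
have E1 : \sum_j p.2 0 j * detab k (dz j (Lb r)) p = \sum_j p.2 0 j * detab r (dz j (Lb k)) p.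
  by apply: eq_bigr => j _; rewrite Ej.
have E2 : \sum_i detab k (g i r) p * G i p = \sum_i detab r (g i k) p * G i p.
  by apply: eq_bigr => i _; rewrite (detab_gten_sym _ _ _ Wp).
exact: (etrans (D r k) (etrans (f_equal2 (fun x y : R[i] => 2^-1 * x - y) E1 E2)
  (esym (D k r)))).
Qed.

Lemma gten_cLb r j k p : W p -> \sum_i g i r p * cLb L i j k p =
  2^-1 * (hderive_bar (cN L) k (g j r) p - hderive_bar (cN L) r (g j k) p).
Proof.
move=> Wp; under eq_bigr do rewrite /cLb mulrCA.
rewrite -mulr_sumr; congr (_ * _).
exact: (ginv_gten (fun l => hderive_bar (cN L) k (g j l) p -
  hderive_bar (cN L) l (g j k) p) r Wp).
Qed.

Lemma BLb_cLb_spray_holo :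
  (forall p, W p -> forall i j k, BLb L i j k p = cLb L i j k p) -> spray_holo_on.
Proof.
move=> H p Wp i k.
pose A r k := \sum_i g i r p * detab k (G i) p.
pose X r k j := 2^-1 * (hderive_bar (cN L) k (g j r) p - hderive_bar (cN L) r (g j k) p).
(* The factor 2 is the degree of the spray in eta, through [euler_detab]. *)
have E r k' : 2 * A r k' = \sum_j p.2 0 j * X r k' j.
  transitivity (\sum_j \sum_i g i r p * (p.2 0 j * deta j (detab k' (G i)) p)).
    rewrite exchange_big /= /A mulr_sumr; apply: eq_bigr => a _.
    rewrite -mulr_sumr (euler_detab _ (smooth_spray a) (homog_spray a) Wp).
    by rewrite mulrCA.
  apply: eq_bigr => j _; rewrite /X -(gten_cLb _ _ _ Wp) mulr_sumr.
  by apply: eq_bigr => a _; rewrite mulrCA -(BLbE _ _ _ Wp) H.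
have A0 r : A r k = 0.
  have XN j : X r k j + X k r j = 0.
    have alg (a b : R[i]) : 2^-1 * (a - b) + 2^-1 * (b - a) = 0 by ring.
    exact: alg.
  have AC : A r k = A k r := gten_detab_spray_sym r k Wp.
  clearbody A X.
  have A2 : 2 * A r k + 2 * A k r = 0.
    rewrite (E r k) (E k r) -big_split /= big1 // => j _.
    by rewrite -mulrDr XN mulr0.
  move: A2; rewrite -AC -mulrDr => /eqP.
  by rewrite mulf_eq0 pnatr_eq0 /= -mulr2n mulrn_eq0 /= => /eqP.
apply: (gten_inj (X := fun i => detab k (G i) p) (Y := fun=> 0) Wp) => m.
by rewrite [LHS]A0 big1// => a _; rewrite mulr0.
Qed.

Lemma BLb_cLb_kahler :
  (forall p, W p -> forall i j k, BLb L i j k p = cLb L i j k p) -> kahler_on.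
Proof.
move=> H; have hol := BLb_cLb_spray_holo H.
move=> p Wp i k.
(* The vanishing of the Rund mixed coefficients, lowered and conjugated. *)
have hsym r k' j : hderive (cN L) k' (g r j) p = hderive (cN L) r (g k' j) p.
  have := gten_cLb r j k' Wp; rewrite big1 => [|a _].
    move=> /esym/eqP; rewrite mulf_eq0 invr_eq0 pnatr_eq0 /= subr_eq0.
    rewrite !(hderive_bar_gten _ _ _ _ Wp) => /eqP E.
    exact: (can_inj (@conjCK _) E).
  by rewrite -H// (holo_BLb _ _ _ hol Wp) mulr0.
have NE m : N m k p = \sum_r p.2 0 r * cfL L m k r p.
  apply: (gten_inj (X := fun m => N m k p)
    (Y := fun m => \sum_r p.2 0 r * cfL L m k r p) Wp) => j.
  rewrite (gten_cfN _ _ Wp) -(eta_hderive (cN L) _ _ Wp).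
  under eq_bigr do rewrite hsym.
  (* After the exchange of indices eta is contracted with the index of the derivation itself, where
     [cN] may be replaced by [N] thanks to [eta_cN]. *)
  transitivity (\sum_r p.2 0 r * hderive N r (g k j) p); last first.
    under [RHS]eq_bigr do rewrite mulr_sumr.
    rewrite exchange_big /=; apply: eq_bigr => r _.
    rewrite -(gten_cfL _ _ _ Wp) mulr_sumr.
    by apply: eq_bigr => a _; rewrite mulrCA.
  rewrite /hderive; under eq_bigr do rewrite mulrBr mulr_sumr.
  under [RHS]eq_bigr do rewrite mulrBr mulr_sumr.
  rewrite !sumrB; congr (_ - _).
  rewrite exchange_big /= [RHS]exchange_big /=; apply: eq_bigr => a _.
  under eq_bigr do rewrite mulrA.
  under [RHS]eq_bigr do rewrite mulrA.
  by rewrite -!mulr_suml (eta_cN _ Wp).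
by rewrite (torsion_cfN _ _ Wp) -NE subrr.
Qed.

(** Both sides vanish. For the right-hand one, [cfL] inherits the symmetry of [BL], and in lowered
    form this says that [hderive N k (g l j)] is symmetric in [k] and [l]. *)
Lemma kahler_BLb_cLb : kahler_on -> spray_holo_on ->
  forall p, W p -> forall i j k, BLb L i j k p = cLb L i j k p.
Proof.
move=> K hol p Wp i j k; rewrite (holo_BLb _ _ _ hol Wp).
have hE k' f : hderive (cN L) k' f p = hderive N k' f p.
  congr (_ - _); apply: eq_bigr => a _; congr (_ * _).
  by move/kahler_cN: K => ->.
have Ec m a b : cfL L m a b p = cfL L m b a p.
  exact: (etrans (esym (kahler_BL m a b K Wp))
    (etrans (BL_sym m a b Wp) (kahler_BL m b a K Wp))).
have Eh l : hderive N k (g l j) p = hderive N l (g k j) p.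
  rewrite -(gten_cfL j l k Wp) -(gten_cfL j k l Wp).
  by apply: eq_bigr => m _; rewrite (Ec m l k).
apply/esym; rewrite /cLb big1 ?mulr0// => l _.
rewrite (hderive_bar_gten (cN L) k j l Wp) (hderive_bar_gten (cN L) l j k Wp).
by rewrite !hE Eh subrr mulr0.
Qed.

(** With [cN = N], [BL = cfL] and no mixed coefficients, what remains is the metric compatibility of
    the Chern-Finsler connection, that is [gten_cfL]. *)
Lemma kahler_Bcov : kahler_on -> spray_holo_on ->
  forall p, W p -> forall i j k, Bcov_g L i j k p = 0.
Proof.
move=> K hol p Wp i j k; rewrite /Bcov_g.
have -> : hderive (cN L) k (gten L i j) p = hderive N k (g i j) p.
  congr (_ - _); apply: eq_bigr => a _; congr (_ * _).
  by move/kahler_cN: K => ->.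
rewrite -(gten_cfL _ _ _ Wp) [X in _ - X]big1 => [|m _]; last first.
  by rewrite (holo_BLb _ _ _ hol Wp) conjC0 mul0r.
rewrite subr0; apply/eqP; rewrite subr_eq0; apply/eqP; apply: eq_bigr => l _.
by rewrite (kahler_BL _ _ _ K Wp) mulrC.
Qed.

(** The contraction with eta turns the derivative of [g] into the lowered [N] and, by Euler's
    identity in degree 1, the Berwald term into the lowered [cN]. *)
Lemma Bcov_kahler : (forall p, W p -> forall i j k, Bcov_g L i j k p = 0) ->
  spray_holo_on -> kahler_on.
Proof.
move=> B hol; apply/kahler_cN => p Wp i k.
apply: (gten_inj (X := fun i => cN L i k p) (Y := fun i => N i k p) Wp) => j.
rewrite (gten_cfN _ _ Wp) -(eta_hderive (cN L) _ _ Wp).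
have E r : hderive (cN L) k (g r j) p = \sum_l BL L l r k p * g l j p.
  have := B p Wp r j k; rewrite /Bcov_g [X in _ - X]big1 => [|m _]; last first.
    by rewrite (holo_BLb _ _ _ hol Wp) conjC0 mul0r.
  by rewrite subr0 => /eqP; rewrite subr_eq0 => /eqP.
under [RHS]eq_bigr do rewrite E mulr_sumr.
rewrite exchange_big /=; apply: eq_bigr => l _.
under [RHS]eq_bigr do rewrite mulrA.
rewrite -mulr_suml mulrC; congr (_ * _).
under [RHS]eq_bigr do rewrite (BL_sym _ _ _ Wp).
by rewrite (euler W_open W_neq0 (smooth_cN l k) (homog_cN l k) Wp) mul1r.
Qed.

End FinslerIdentities.

(** * The set [slit a] and the Lagrangian in a chart satisfy the hypotheses made on [W] and [L] *)

Section FinslerChart.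
Variables (R : realType) (n : nat) (M : complexManifold R n) (F : finslerMetric M).
Variable a : chart M.
Implicit Types (p : pt R n).

Lemma slit_open : open (@slit R n M a).
Proof.
have -> : @slit R n M a = (fst @^-1` (chart_map a @` chart_dom a)) `&`
    (snd @^-1` (~` [set (0 : 'rV[R[i]]_n)])).
  by apply/seteqP; split => p [h1 /eqP h2]; split => //; apply/eqP.
apply: openI.
  apply: open_comp; last exact: chart_map_open.
  by move=> x _; exact: cvg_fst.
apply: open_comp; first by move=> x _; exact: cvg_snd.
apply: closed_openC; apply: accessible_closed_set1.
apply: hausdorff_accessible; exact: norm_hausdorff.
Qed.

Lemma slit_fiber z (eta eta' : 'rV[R[i]]_n) :
  slit a (z, eta) -> eta' != 0 -> slit a (z, eta').
Proof. by case. Qed.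

Lemma slit_neq0 p : slit a p -> p.2 != 0.
Proof. by case. Qed.

Lemma lagrangian_smooth : smooth (slit a) (lagrangian F a).
Proof. exact: metric_smooth. Qed.

Lemma lagrangian_homog : homog (slit a) 1 1 (lagrangian F a).
Proof.
move=> [z eta] l [dp _] l0; rewrite /lagrangian /scal !expr1 !rmorphXn /=.
rewrite (metric_homogeneous F l dp) exprMn; congr (_ * _).
by rewrite normCK.
Qed.

Lemma lagrangian_real p : ((lagrangian F a p)^*)%R = lagrangian F a p.
Proof. by rewrite conjCE conjc_real. Qed.

(** A nonzero row vector in the left kernel would make the positive definite Hermitian form
    vanish. *)
Lemma gmx_unit p : slit a p -> gmx (lagrangian F a) p \in unitmx.
Proof.
move=> Wp; rewrite -row_free_unit -kermx_eq0; apply/negPn/negP => /rowV0Pn[v].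
move=> /sub_kermxP vg v0; have := metric_posdef F Wp v0.
rewrite exchange_big /= big1 ?ltxx// => j _.
have := congr1 (fun A : 'rV__ => A 0 j) vg; rewrite !mxE => E.
rewrite -[RHS](mul0r ((v 0 j)^*)%R) -[X in _ = X * _]E mulr_suml.
by apply: eq_bigr => i _; rewrite mxE [in RHS]mulrC [v 0 i * _]mulrC mulrC.
Qed.

End FinslerChart.

Theorem theorem3p4 (R : realType) (n : nat) (M : complexManifold R n)
    (F : finslerMetric M) :
  [<-> G_kahler F;
       forall a p, slit a p -> forall i j k : 'I_n,
         BLb (lagrangian F a) i j k p = cLb (lagrangian F a) i j k p;
       (forall a p, slit a p -> forall i j k : 'I_n,
         BL (lagrangian F a) i j k p = cfL (lagrangian F a) i j k p) /\
       (forall i j k : 'I_n, only_z (fun a => cfL (lagrangian F a) i j k));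
       berwald F;
       (forall a p, slit a p -> forall i j k : 'I_n,
         Bcov_g (lagrangian F a) i j k p = 0) /\
       (forall a p, slit a p -> forall i h : 'I_n,
         detab h (spray (lagrangian F a) i) p = 0)].
Proof.
have Wo a := @slit_open R n M a.
have Wf a := @slit_fiber R n M a.
have W0 a := @slit_neq0 R n M a.
have SL a := lagrangian_smooth F a.
have HL a := lagrangian_homog F (a := a).
have RL a p (_ : slit a p) := lagrangian_real F a p.
have UL a := gmx_unit F (a := a).
tfae.
- move=> [K H] a.
  exact: (kahler_BLb_cLb (Wo a) (Wf a) (W0 a) (SL a) (HL a) (RL a) (UL a) (K a) (H a)).
- move=> B.
  have K a := BLb_cLb_kahler (Wo a) (Wf a) (W0 a) (SL a) (HL a) (RL a) (UL a) (B a).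
  have H a := BLb_cLb_spray_holo (Wo a) (Wf a) (W0 a) (SL a) (HL a) (UL a) (B a).
  split=> [a p Wp i j k|i j k a z eta eta'].
    exact: (kahler_BL (Wo a) (Wf a) (W0 a) (SL a) (HL a) (UL a) i j k (K a) Wp).
  exact: (kahler_cfL_only_z (Wo a) (Wf a) (W0 a) (SL a) (HL a) (UL a) i j k (K a) (H a)).
(* As a second derivative of the spray, [BL] is symmetric in its lower indices; equality with [cfL]
   therefore kills the whole torsion, not only its contraction. *)
- move=> [B Z]; split=> // a p Wp i k; apply: big1 => j _.
  rewrite /torsion -(B a p Wp) -(B a p Wp).
  rewrite (BL_sym (Wo a) (Wf a) (W0 a) (SL a) (HL a) (UL a) i j k Wp).
  by rewrite subrr mul0r.
- move=> [K Z].
  have H a := only_z_spray_holo (Wo a) (Wf a) (W0 a) (SL a) (HL a) (UL a)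
    (fun i j k => Z i j k a).
  split=> // a.
  exact: (kahler_Bcov (Wo a) (Wf a) (W0 a) (SL a) (HL a) (UL a) (K a) (H a)).
- move=> [B H]; split=> // a.
  exact: (Bcov_kahler (Wo a) (Wf a) (W0 a) (SL a) (HL a) (UL a) (B a) (H a)).
Qed.
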